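(* There is a 1-1 correspondence between $\tilde x\in\tilde L^2_+(\mathbb{R}^d)$ and $\mu\in S_+(\mathbb{R}^d)$ which is given by $$\tilde x(s,\cdot)=\int_{\mathbb{R}^d}g_d(s,\cdot-z)\,\mu(dz),\qquad s>0.$$
   Context: For $s>0$, $x\in\mathbb{R}^d$, $g_d(s,x)=(2\pi s)^{-d/2}\exp\{-|x|^2/2s\}$, where $|\cdot|$ is the Euclidean norm. $(T_t)_{t\ge0}$ is the transition semigroup of standard Brownian motion on $\mathbb{R}^d$, acting on $L^2(\mathbb{R}^d)$ (Lebesgue measure): $T_tf(x)=\int g_d(t,y-x)f(y)\,dy$ for $t>0$, $T_0=I$. An entrance path for $(T_t)_{t\ge0}$ is a path $\tilde x=\{\tilde x(s):s>0\}$ in $L^2(\mathbb{R}^d)$, with $\tilde x(s)=\tilde x(s,\cdot)$, such that $\tilde x(r+t)=T_t\tilde x(r)$ for all $r,t>0$. $\tilde L^2(\mathbb{R}^d)$ is the set of entrance paths that are locally square integrable, i.e. $\int_0^l\|\tilde x(s)\|^2_{L^2(\mathbb{R}^d)}ds<\infty$ for some $l>0$, and $\tilde L^2_+(\mathbb{R}^d)$ is its subset of non-negative elements ($\tilde x(s,\cdot)\ge0$ for all $s>0$). $S(\mathbb{R}^d)$ is the set of signed measures $\mu$ on $\mathbb{R}^d$ with total variation measure $\|\mu\|$ satisfying $$\int_0^l ds\int_{\mathbb{R}^d}\|\mu\|(dx)\int_{\mathbb{R}^d}g_d(2s,y-x)\,\|\mu\|(dy)<\infty$$ for some $l>0$,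 and $S_+(\mathbb{R}^d)$ is its subset of non-negative elements, i.e. the non-negative (not necessarily finite) Borel measures $\mu$ satisfying this condition with $\|\mu\|=\mu$. *)

(* Defs.v *)
From HB Require Import structures.
From mathcomp Require Import all_boot all_order all_algebra.
From mathcomp Require Import all_classical all_reals all_analysis.

Set Implicit Arguments.
Unset Strict Implicit.
Unset Printing Implicit Defensive.
Import Order.TTheory GRing.Theory Num.Theory.
Import numFieldNormedType.Exports.

Local Open Scope classical_set_scope.
Local Open Scope ring_scope.

(* The sigma-algebra on d.-tuple is the one generated by the coordinates, which
   for real coordinates is the Borel sigma-algebra of R^d. *)
Definition euclid (R : realType) (d : nat) := d.-tuple (measurableTypeR R).

Section lebesgue_step.
Context (R : realType) (n : nat).
Variable m : {sigma_finite_measure set (euclid R n) -> \bar R}.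

Definition euclid_cons (p : measurableTypeR R * euclid R n) : euclid R n.+1 :=
  [tuple of p.1 :: p.2].

Lemma measurable_euclid_cons : measurable_fun [set: _] euclid_cons.
Proof. exact: measurable_cons. Qed.

Definition lebesgue_step : set (euclid R n.+1) -> \bar R :=
  pushforward (@lebesgue_measure R \x m)%E euclid_cons.

Let M : {measure set (euclid R n.+1) -> \bar R} :=
  measure_function_pushforward__canonical__measure_function_Measure
    (@lebesgue_measure R \x m)%E measurable_euclid_cons.

HB.instance Definition _ := isMeasure.Build _ _ _ lebesgue_step
  (measure0 M) (measure_ge0 M) (@measure_semi_sigma_additive _ _ _ M).

Lemma lebesgue_step_sigma_finite : sigma_finite [set: _] lebesgue_step.
Proof.
have /sigma_finiteP[F [TF ndF Foo]] := sigma_finiteT (@lebesgue_measure R).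
have /sigma_finiteP[G [TG ndG Goo]] := sigma_finiteT m.
pose H k := [set v : euclid R n.+1 | F k (thead v) /\ G k [tuple of behead v]].
exists H => [|k].
  rewrite predeqE => v; split => // _.
  have [i _ Fi] : (\bigcup_i F i) (thead v) by rewrite -TF.
  have [j _ Gj] : (\bigcup_i G i) [tuple of behead v] by rewrite -TG.
  exists (maxn i j) => //; split.
    by move: Fi; exact/subsetPset/ndF/leq_maxl.
  by move: Gj; exact/subsetPset/ndG/leq_maxr.
have [mF Fk] := Foo k; have [mG Gk] := Goo k; split.
  apply: measurableI.
    rewrite -[X in measurable X]setTI.
    by apply: (measurable_tnth ord0).
  by rewrite -[X in measurable X]setTI; exact: measurable_behead.
rewrite /lebesgue_step /pushforward (_ : _ @^-1` _ = F k `*` G k).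
  by rewrite product_measure1E//= lte_mul_pinfty// ge0_fin_numE.
have consE p : [tuple of behead (euclid_cons p)] = p.2 :> n.-tuple _.
  exact/val_inj.
by apply/seteqP; split=> -[x t]; rewrite /H /= consE.
Qed.

HB.instance Definition _ := Measure_isSigmaFinite.Build _ _ _ lebesgue_step
  lebesgue_step_sigma_finite.

End lebesgue_step.

(* Lebesgue measure on R^d as an iterated product; see lebesgue_euclid_box. *)
Fixpoint lebesgue_euclid (R : realType) (d : nat) :
    {sigma_finite_measure set (euclid R d) -> \bar R} :=
  if d is n.+1 then lebesgue_step (lebesgue_euclid R n)
  else dirac ([tuple] : euclid R 0).

Lemma lebesgue_euclid_box (R : realType) (d : nat)
    (A : 'I_d -> set (measurableTypeR R)) : (forall i, measurable (A i)) ->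
  lebesgue_euclid R d [set x | forall i, A i (tnth x i)] =
  (\prod_(i < d) lebesgue_measure (A i))%E.
Proof.
elim: d A => [|n IHn] A mA /=.
  by rewrite big_ord0 diracE mem_set// => -[].
rewrite big_ord_recl -IHn // /lebesgue_step /pushforward.
rewrite -product_measure1E //.
  congr (_ _); apply/seteqP; split=> -[x t] /=.
    move=> At; split=> [|i]; first exact: (At ord0).
    by move: (At (lift ord0 i)); rewrite tnthS.
  move=> [A0x At] i; have [->|i0] := eqVneq i ord0; first exact: A0x.
  have [j ->] : exists j, i = lift ord0 j.
    by case: (unliftP ord0 i) i0 => [j -> _|->]; [exists j|rewrite eqxx].
  by move: (At j); rewrite tnthS.
rewrite (_ : [set _ | _] = \bigcap_(i in [set: 'I_n])
    ((@tnth n _ ^~ i) @^-1` A (lift ord0 i))).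
  apply: fin_bigcap_measurable => // i _.
  by rewrite -[X in measurable X]setTI; exact: measurable_tnth.
by apply/seteqP; split=> x h i; [move=> _; exact: h|exact: h].
Qed.

Definition euclid_sub (R : realType) (d : nat) (x y : euclid R d) : euclid R d :=
  [tuple (tnth x i : R) - tnth y i | i < d].

Definition euclid_norm (R : realType) (d : nat) (x : euclid R d) : R :=
  Num.sqrt (\sum_(i < d) (tnth x i : R) ^+ 2).

Definition heat_kernel (R : realType) (d : nat) (s : R) (x : euclid R d) : R :=
  (2 * pi * s) `^ (- (d%:R / 2)) * expR (- (euclid_norm x ^+ 2 / (2 * s))).

Definition brownian_semigroup (R : realType) (d : nat) (t : R)
    (f : euclid R d -> R) (x : euclid R d) : R :=
  if 0 < t then
    (\int[lebesgue_euclid R d]_y (heat_kernel t (euclid_sub y x) * f y))%R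
  else f x.

(* Elements are classes of measurable functions modulo Lebesgue-a.e. equality;
   the coercion to functions picks a representative. *)
Definition L2 (R : realType) (d : nat) := LspaceType2 (lebesgue_euclid R d).

(* Paths are total functions of s : R whose values at s <= 0 are irrelevant. *)
Definition path_equal (R : realType) (d : nat) (x y : R -> L2 R d) : Prop :=
  forall s, 0 < s -> x s = y s.

Definition entrance_path (R : realType) (d : nat) (x : R -> L2 R d) : Prop :=
  forall r t, 0 < r -> 0 < t ->
    x (r + t) = brownian_semigroup t (x r) %[ae lebesgue_euclid R d].

Definition locally_square_integrable (R : realType) (d : nat)
    (x : R -> L2 R d) : Prop :=
  exists2 l : R, 0 < l &
    (\int[lebesgue_measure]_(s in `]0%R, l[)
       'N[lebesgue_euclid R d]_2%:E[EFin \o x s] ^+ 2 < +oo)%E.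

Definition nonnegative_path (R : realType) (d : nat) (x : R -> L2 R d) : Prop :=
  forall s, 0 < s -> {ae lebesgue_euclid R d, forall y, 0 <= x s y}.

Definition Ltilde2_plus (R : realType) (d : nat) (x : R -> L2 R d) : Prop :=
  [/\ entrance_path x, locally_square_integrable x & nonnegative_path x].

Definition S_plus (R : realType) (d : nat)
    (mu : {measure set (euclid R d) -> \bar R}) : Prop :=
  exists2 l : R, 0 < l &
    (\int[lebesgue_measure]_(s in `]0%R, l[)
       \int[mu]_x \int[mu]_y (heat_kernel (2 * s)%R (euclid_sub y x))%:E
     < +oo)%E.

(* Measures are functions on all sets, so equality is tested on measurable
   sets only. *)
Definition measure_equal (R : realType) (d : nat)
    (mu nu : {measure set (euclid R d) -> \bar R}) : Prop :=
  forall A, measurable A -> mu A = nu A.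

Definition heat_potential (R : realType) (d : nat)
    (mu : {measure set (euclid R d) -> \bar R}) (s : R) (y : euclid R d) :
    \bar R :=
  (\int[mu]_z (heat_kernel s (euclid_sub y z))%:E)%E.

Definition represents (R : realType) (d : nat)
    (mu : {measure set (euclid R d) -> \bar R}) (x : R -> L2 R d) : Prop :=
  forall s, 0 < s ->
    EFin \o x s = heat_potential mu s %[ae lebesgue_euclid R d].

(* Main.v *)
(* Write g for the heat kernel and g_s * mu for the potential of mu.

   From mu to x: by Chapman-Kolmogorov and Tonelli, the squared L^2 norm of
   g_s * mu is the double integral of g(2s, y - x), so x(s) = g_s * mu is locally
   square integrable, and since the semigroup contracts L^2 it is in L^2 for every
   s > 0.  Tonelli applies because one finite value of g_s * mu forces mu to be
   sigma-finite.

   Uniqueness: if h is bounded and Lipschitz, then integrating h g(1 - s, . - x0)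
   against g_s * mu gives the integral of h g(1, . - x0) against mu up to an error
   O(sqrt s), hence g_s * mu determines the latter.  Lipschitz functions increase
   to indicators of open orthants, which form a generating pi-system.

   From x to mu: the measures g(1, .) x(r) have bounded mass as r -> 0.  Code a
   point of R^d by the bits [q <= y_i], q rational.  The masses of the finite bit
   patterns have limits along an ultrafilter; these limits are additive, so they are
   the lengths of nested intervals, and mapping a point of the line to the limit of
   points with the corresponding patterns pushes Lebesgue measure to a limit measure
   on R^d.  Patterns that run off to infinity do not matter, because it suffices to
   test against heat kernels.  For t < 1 the quotient g(t, . - z) / g(1, .) is a
   multiple of a heat kernel, so dividing the limit measure by g(1, .) gives a mu
   with g_t * mu = x(t) for t < 1, and then for all t by the semigroup property. *)

Require Import Defs.
From HB Require Import structures.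
From mathcomp Require Import all_boot all_order all_algebra.
From mathcomp Require Import all_classical all_reals all_analysis.
From mathcomp Require Import measurable_realfun.
From mathcomp Require Import ring lra.
Set Implicit Arguments.
Unset Strict Implicit.
Unset Printing Implicit Defensive.
Import Order.TTheory GRing.Theory Num.Theory.
Import numFieldNormedType.Exports.
Local Open Scope classical_set_scope.
Local Open Scope ring_scope.

(** * The heat kernel *)

Section euclid_integral.
Context (R : realType).

Lemma measurable_coord (d : nat) (i : 'I_d) :
  measurable_fun setT (fun y : euclid R d => tnth y i : measurableTypeR R).
Proof. exact: measurable_tnth. Qed.

Lemma measurable_prod_coord (d : nat) (f : 'I_d -> R -> R) :
  (forall i, measurable_fun setT (f i)) ->
  measurable_fun setT (fun y : euclid R d => \prod_(i < d) f i (tnth y i)).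
Proof.
move=> mf; apply: measurable_prod => i _.
by apply: (measurableT_comp (mf i)); exact: measurable_coord.
Qed.

(** Induction on the dimension: [lebesgue_euclid] is the pushforward of a product measure under
    [euclid_cons], so Tonelli splits off the first coordinate. In dimension 0 it is the Dirac mass
    at the empty tuple. *)
Lemma integral_prod_coord (d : nat) (f : 'I_d -> R -> R) :
  (forall i, measurable_fun setT (f i)) -> (forall i x, 0 <= f i x) ->
  (forall i, \int[lebesgue_measure]_x (f i x)%:E = 1)%E ->
  (\int[lebesgue_euclid R d]_y (\prod_(i < d) f i (tnth y i))%:E = 1)%E.
Proof.
elim: d f => [|n IH] f mf f0 f1; have mF := measurable_prod_coord mf.
  rewrite /= integral_dirac//; last by apply/measurable_EFinP; exact: mF.
  by rewrite big_ord0 diracE mem_set// mul1e.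
rewrite /= /lebesgue_step ge0_integral_pushforward//; last 3 first.
- exact: measurable_euclid_cons.
- exact/measurable_EFinP.
- by move=> y _; rewrite lee_fin prodr_ge0.
rewrite preimage_setT (fubini_tonelli1 (_ \o _))/=; last 2 first.
- apply/measurable_EFinP.
  exact: (measurableT_comp mF (@measurable_euclid_cons R n)).
- by move=> y; rewrite lee_fin prodr_ge0.
rewrite -[RHS](f1 ord0); apply: eq_integral => x _; rewrite /fubini_F /=.
have mG : measurable_fun setT
    (fun y : euclid R n => \prod_(i < n) f (lift ord0 i) (tnth y i)).
  exact: (measurable_prod_coord (f := fun i => f (lift ord0 i))).
transitivity (\int[lebesgue_euclid R n]_y
    ((f ord0 x)%:E * (\prod_(i < n) f (lift ord0 i) (tnth y i))%:E))%E.
  apply: eq_integral => y _; rewrite big_ord_recl EFinM.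
  by congr (_ * _%:E)%E; apply: eq_bigr => i _; rewrite tnthS.
rewrite ge0_integralZl//; last 3 first.
- exact/measurable_EFinP.
- by move=> y _; rewrite lee_fin prodr_ge0.
- by rewrite lee_fin.
by rewrite (IH (fun i => f (lift ord0 i)))// mule1.
Qed.

End euclid_integral.

(** * Gaussian identities and pointwise bounds *)

Section kernel.
Context (R : realType) (d : nat).
Implicit Types (s t : R) (x y z : euclid R d).

Definition sqdist y x : R := \sum_(i < d) (tnth y i - tnth x i) ^+ 2.

Definition kern s y x : R := heat_kernel s (euclid_sub y x).

Lemma sqdist_ge0 y x : 0 <= sqdist y x.
Proof. by apply: sumr_ge0 => i _; rewrite sqr_ge0. Qed.

Lemma sqdistC y x : sqdist y x = sqdist x y.
Proof. by apply: eq_bigr => i _; rewrite -sqrrN opprB. Qed.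

Lemma kernE s y x :
  kern s y x = (2 * pi * s) `^ (- (d%:R / 2)) * expR (- (sqdist y x / (2 * s))).
Proof.
rewrite /kern /heat_kernel /euclid_norm sqr_sqrtr; last first.
  by apply: sumr_ge0 => i _; rewrite sqr_ge0.
rewrite (_ : \sum_(i < d) _ = sqdist y x)//.
by apply: eq_bigr => i _; rewrite tnth_mktuple.
Qed.

Lemma kernC s y x : kern s y x = kern s x y.
Proof. by rewrite !kernE sqdistC. Qed.

Lemma kern_gt0 s y x : 0 < s -> 0 < kern s y x.
Proof.
by move=> s0; rewrite kernE mulr_gt0 ?expR_gt0// powR_gt0// !mulr_gt0// pi_gt0.
Qed.

Lemma kern_ge0 s y x : 0 <= kern s y x.
Proof. by rewrite kernE mulr_ge0 ?expR_ge0// powR_ge0. Qed.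

Lemma kern_le s y x : 0 < s -> kern s y x <= (2 * pi * s) `^ (- (d%:R / 2)).
Proof.
move=> s0; rewrite kernE ler_piMr ?powR_ge0// -[leRHS]expR0 ler_expR oppr_le0.
by rewrite divr_ge0 ?sqdist_ge0// mulr_ge0// ltW.
Qed.

Lemma measurable_sqdist2 :
  measurable_fun setT (fun p : euclid R d * euclid R d => sqdist p.1 p.2).
Proof.
apply: measurable_sum => i; apply: measurable_funX; apply: measurable_funB.
- exact: (measurableT_comp (measurable_coord i)).
- exact: (measurableT_comp (measurable_coord i)).
Qed.

Lemma measurable_kern2 s :
  measurable_fun setT (fun p : euclid R d * euclid R d => kern s p.1 p.2).
Proof.
under eq_fun do rewrite kernE.
apply: measurable_funM => //; apply: measurableT_comp => //.
apply: measurableT_comp => //; apply: measurable_funM => //.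
exact: measurable_sqdist2.
Qed.

Lemma measurable_kern s x : measurable_fun setT (fun y => kern s y x).
Proof. exact: (measurableT_comp (measurable_kern2 s) (pair2_measurable x)). Qed.

(** Reduces the total mass of the kernel to that of one-dimensional normal densities of variance
    [s]. *)
Lemma kern_prod s y x : 0 < s ->
  kern s y x = \prod_(i < d) normal_pdf (tnth x i : R) (Num.sqrt s) (tnth y i).
Proof.
move=> s0; have s0' : Num.sqrt s != 0 by rewrite gt_eqF// sqrtr_gt0.
rewrite kernE /sqdist; under [RHS]eq_bigr => i _ do rewrite normal_pdfE//.
rewrite big_split/= prodr_const card_ord; congr (_ * _).
  rewrite /normal_peak sqr_sqrtr ?ltW// -[in RHS]mulr_natr.
  rewrite (_ : _ * 2 = 2 * pi * s) -?powR12_sqrt; [|by rewrite !mulr_ge0 ?pi_ge0 ?ltW|ring].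
  by rewrite powRN exprVn -powR_mulrn ?powR_ge0// -powRrM [d%:R / 2]mulrC.
rewrite -expR_sum; congr expR; rewrite mulr_suml -sumrN; apply: eq_bigr => i _.
by rewrite sqr_sqrtr ?ltW// mulNr mulr_natl.
Qed.

Lemma integral_kern s x : 0 < s ->
  (\int[lebesgue_euclid R d]_y (kern s y x)%:E = 1)%E.
Proof.
move=> s0; under eq_integral do rewrite kern_prod//.
apply: (integral_prod_coord
  (f := fun i => normal_pdf (tnth x i : R) (Num.sqrt s))) => i.
- exact: measurable_normal_pdf.
- by move=> v; exact: normal_pdf_ge0.
- exact: integral_normal_pdf.
Qed.

(* Completing the square in each coordinate. *)
Lemma kernM s t y x z : 0 < s -> 0 < t -> kern s y x * kern t y z =
  kern (s + t) x z * kern (s * t / (s + t)) y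
    [tuple (t * tnth x i + s * tnth z i) / (s + t) | i < d].
Proof.
move=> s0 t0; have st0 : 0 < s + t by rewrite addr_gt0.
rewrite !kernE mulrACA [in RHS]mulrACA -!powRM; last 4 first.
- by rewrite !mulr_ge0 ?pi_ge0 ?ltW.
- by rewrite !mulr_ge0 ?invr_ge0 ?pi_ge0 ?ltW// mulr_gt0.
- by rewrite !mulr_ge0 ?pi_ge0 ?ltW.
- by rewrite !mulr_ge0 ?pi_ge0 ?ltW.
congr (_ `^ _ * _); first by field; rewrite gt_eqF.
rewrite -!expRD; congr expR; rewrite -!opprD; congr (- _).
rewrite !mulr_suml -!big_split/=; apply: eq_bigr => i _; rewrite tnth_mktuple.
by field; rewrite ?gt_eqF.
Qed.

(** Chapman-Kolmogorov: after completing the square, one factor does not involve [y] and the other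
    has mass 1. *)
Lemma integral_kernM s t x z : 0 < s -> 0 < t ->
  (\int[lebesgue_euclid R d]_y (kern s y x * kern t y z)%:E =
   (kern (s + t) x z)%:E)%E.
Proof.
move=> s0 t0; have st0 : 0 < s + t by rewrite addr_gt0.
under eq_integral do rewrite kernM// EFinM.
rewrite ge0_integralZl_EFin ?kern_ge0//; last 2 first.
- by move=> y _; rewrite lee_fin kern_ge0.
- by apply/measurable_EFinP; exact: measurable_kern.
by rewrite integral_kern ?mule1// divr_gt0// mulr_gt0.
Qed.

(** The exponential factor increases with time, and the constant is exactly the ratio of the two
    prefactors. It serves to dominate kernels at varying times by a single one. *)
Lemma kern_mono s t y x : 0 < s -> s <= t ->
  kern s y x <= (t / s) `^ (d%:R / 2) * kern t y x.
Proof.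
move=> s0 st; have t0 := lt_le_trans s0 st.
have -> : (t / s) `^ (d%:R / 2) * kern t y x =
    (2 * pi * s) `^ (- (d%:R / 2)) * expR (- (sqdist y x / (2 * t))).
  rewrite kernE mulrA; congr (_ * _).
  rewrite (_ : 2 * pi * t = (2 * pi * s) * (t / s)); last by field; rewrite gt_eqF.
  rewrite [X in _ * X]powRM; last 2 first.
  - by rewrite !mulr_ge0 ?pi_ge0 ?ltW.
  - by rewrite divr_ge0 ?ltW.
  rewrite (powRN (t / s)) mulrCA divff ?mulr1//.
  by rewrite gt_eqF// powR_gt0// divr_gt0.
rewrite kernE ler_wpM2l ?powR_ge0// ler_expR lerN2 ler_wpM2l ?sqdist_ge0//.
by rewrite lef_pV2 ?posrE ?mulr_gt0// ler_wpM2l.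
Qed.

(* [a exp(-a^2/2) <= exp(-a^2/4)] with [a = |y - x| / sqrt s]. *)
Lemma kern_dist s y x : 0 < s ->
  Num.sqrt (sqdist y x) * kern s y x <=
  Num.sqrt s * 2 `^ (d%:R / 2) * kern (2 * s) y x.
Proof.
move=> s0; set D := sqdist y x; set a := Num.sqrt D / Num.sqrt s.
have ss0 : 0 < Num.sqrt s by rewrite sqrtr_gt0.
have DE : D = a ^+ 2 * s.
  by rewrite /a exprMn exprVn !sqr_sqrtr ?sqdist_ge0 ?(ltW s0)// divfK ?gt_eqF.
have -> : Num.sqrt D = Num.sqrt s * a by rewrite mulrC divfK// gt_eqF.
rewrite -(mulrA _ a) -(mulrA (Num.sqrt s)) ler_wpM2l ?sqrtr_ge0//.
have -> : 2 `^ (d%:R / 2) * kern (2 * s) y x =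
    (2 * pi * s) `^ (- (d%:R / 2)) * expR (- (a ^+ 2 / 4)).
  rewrite kernE -/D mulrA; congr (_ * _).
    rewrite (_ : 2 * pi * (2 * s) = (2 * pi * s) * 2); last by ring.
    rewrite [X in _ * X]powRM ?ltr0n//; last by rewrite !mulr_ge0 ?pi_ge0 ?ltW.
    by rewrite (powRN 2) mulrCA divff ?mulr1// gt_eqF// powR_gt0.
  by rewrite DE; congr expR; field; rewrite gt_eqF.
rewrite kernE -/D mulrCA ler_wpM2l ?powR_ge0//.
have -> : - (D / (2 * s)) = - (a ^+ 2 / 4) - (a ^+ 2 / 4).
  by rewrite DE; field; rewrite gt_eqF.
rewrite expRD mulrA ler_piMl ?expR_ge0// expRN -ler_pdivlMr ?invr_gt0 ?expR_gt0//.
(* exp(a^2/4) >= 1 + a^2/4 >= a, the last inequality being (a/2 - 1)^2 >= 0. *)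
rewrite div1r invrK (le_trans _ (expR_ge1Dx _))//.
by have := sqr_ge0 (a / 2 - 1); nra.
Qed.

End kernel.

(** * Heat potentials *)

Section measure_lemmas.
Context d0 (T : measurableType d0) (R : realType).
Local Open Scope ereal_scope.

(* The integral of a nonnegative function is a supremum over the simple
   functions below it, measurable or not. *)
Lemma le_integral_nomeas (mu : {measure set T -> \bar R}) (D : set T)
    (f g : T -> \bar R) : (forall x, D x -> 0 <= f x) ->
  (forall x, D x -> f x <= g x) ->
  \int[mu]_(x in D) f x <= \int[mu]_(x in D) g x.
Proof.
move=> f0 fg; rewrite integral_mkcond [leRHS]integral_mkcond.
rewrite !ge0_integralTE; last 2 first.
- by apply: erestrict_ge0 => x Dx; exact: le_trans (f0 _ Dx) (fg _ Dx).
- exact: erestrict_ge0.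
apply: le_ereal_sup => _ [h hf <-]; exists h => // x.
by apply: le_trans (hf x) _; exact: lee_restrict.
Qed.

(** Tonelli is applied to measures that carry the sigma-finite structure; this turns the property
    into the structure without changing the set function. *)
Lemma sigma_finite_pack (mu : {measure set T -> \bar R}) :
  sigma_finite setT mu ->
  exists nu : {sigma_finite_measure set T -> \bar R},
    (nu : set T -> \bar R) = mu.
Proof.
move=> smu; pose H1 := isSFinite.Build _ _ _ _ (sfinite_measure_sigma_finite smu).
pose H2 := isSigmaFinite.Build _ _ _ _ smu.
pose nu := HB.pack_for {sigma_finite_measure set T -> \bar R}
  (Measure.sort mu) H1 H2.
by exists nu.
Qed.

Lemma tonelli_swap d1 (T1 : measurableType d1)
    (m1 : {sigma_finite_measure set T -> \bar R})
    (m2 : {sigma_finite_measure set T1 -> \bar R}) (f : T -> T1 -> \bar R) :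
  measurable_fun setT (fun p => f p.1 p.2) -> (forall x y, 0 <= f x y) ->
  \int[m1]_x \int[m2]_y f x y = \int[m2]_y \int[m1]_x f x y.
Proof. by move=> mf f0; exact: (fubini_tonelli (fun p => f p.1 p.2)). Qed.

Lemma measurable_integral d1 (T1 : measurableType d1)
    (m2 : {sigma_finite_measure set T1 -> \bar R}) (f : T -> T1 -> \bar R) :
  measurable_fun setT (fun p => f p.1 p.2) -> (forall x y, 0 <= f x y) ->
  measurable_fun setT (fun x => \int[m2]_y f x y).
Proof.
by move=> mf f0; exact: (measurable_fun_fubini_tonelli_F (fun p => f p.1 p.2)).
Qed.

End measure_lemmas.

(** * Potentials of measures and the L^2 contraction of the heat semigroup *)

Section potential.
Context (R : realType) (d : nat).
Notation E := (euclid R d).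
Notation L := (lebesgue_euclid R d).
Implicit Types (s t : R) (x y z : E).
Local Open Scope ereal_scope.

Lemma measurable_EFin_kern2 s :
  measurable_fun setT (fun p : E * E => (kern s p.1 p.2)%:E).
Proof. by apply/measurable_EFinP; exact: measurable_kern2. Qed.

Lemma measurable_EFin_kern s x : measurable_fun setT (fun y : E => (kern s y x)%:E).
Proof. by apply/measurable_EFinP; exact: measurable_kern. Qed.

Lemma measurable_EFin_kernr s x : measurable_fun setT (fun y : E => (kern s x y)%:E).
Proof. by under eq_fun do rewrite kernC; exact: measurable_EFin_kern. Qed.

Lemma measurable_kernr s x : measurable_fun setT (fun y : E => kern s x y).
Proof. by under eq_fun do rewrite kernC; exact: measurable_kern. Qed.

(** The kernel is positive, so its superlevel sets [F n] exhaust the space, and Markov's inequality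
    bounds their measures. *)
Lemma kern_sigma_finite (mu : {measure set E -> \bar R}) s x : (0 < s)%R ->
  \int[mu]_z (kern s x z)%:E < +oo -> sigma_finite setT mu.
Proof.
move=> s0 fin; pose F n := [set z : E | (n.+1%:R^-1 <= kern s x z)%R].
have mF n : measurable (F n).
  rewrite (_ : F n = setT `&` kern s x @^-1` [set` `[n.+1%:R^-1, +oo[%R]).
    by apply: measurable_kernr => //; exact: measurable_itv.
  by rewrite setTI; apply/seteqP; split => z /=; rewrite in_itv/= andbT.
exists F => [|n].
  apply/esym/seteqP; split => // z _.
  have k0 := kern_gt0 z x s0; rewrite kernC in k0.
  have [n nk] := ltr_add_invr k0; exists n => //=.
  by rewrite /F/=; rewrite add0r in nk; exact: ltW.
split=> //; rewrite ltNge leye_eq; apply/negP => /eqP Foo.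
have : \int[mu]_(z in F n) (n.+1%:R^-1)%:E <= \int[mu]_z (kern s x z)%:E.
  apply: (@le_trans _ _ (\int[mu]_(z in F n) (kern s x z)%:E)).
    apply: le_integral_nomeas => [z _|z]; last by rewrite lee_fin.
    by rewrite lee_fin invr_ge0.
  apply: ge0_subset_integral => //; first exact: measurable_EFin_kernr.
  by move=> z _; rewrite lee_fin kern_ge0.
rewrite integral_cst// Foo gt0_muley ?lte_fin ?invr_gt0//.
by rewrite leye_eq => /eqP oo; rewrite oo in fin.
Qed.

Section sigma_finite.
Variable mu : {sigma_finite_measure set E -> \bar R}.

(** This is [heat_potential], for measures that carry the sigma-finite structure. *)
Definition pot s x := \int[mu]_z (kern s x z)%:E.

Lemma pot_ge0 s x : 0 <= pot s x.
Proof. by apply: integral_ge0 => z _; rewrite lee_fin kern_ge0. Qed.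

Lemma measurable_pot s : measurable_fun setT (pot s).
Proof.
apply: measurable_integral; first exact: measurable_EFin_kern2.
by move=> x y; rewrite lee_fin kern_ge0.
Qed.

Lemma integral_kern_pot s t x : (0 < s)%R -> (0 < t)%R ->
  \int[L]_y ((kern t y x)%:E * pot s y) = pot (t + s) x.
Proof.
move=> s0 t0.
transitivity (\int[L]_y \int[mu]_z ((kern t y x)%:E * (kern s y z)%:E)).
  apply: eq_integral => y _; rewrite ge0_integralZl_EFin ?kern_ge0//.
  - by move=> z _; rewrite lee_fin kern_ge0.
  - exact: measurable_EFin_kernr.
rewrite tonelli_swap; last 2 first.
- apply: emeasurable_funM; last exact: measurable_EFin_kern2.
  exact: (measurableT_comp (measurable_EFin_kern t x)).
- by move=> y z; rewrite mule_ge0// lee_fin kern_ge0.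
by apply: eq_integral => z _; under eq_integral do rewrite -EFinM;
  rewrite integral_kernM.
Qed.

(** Expand one factor, exchange the integrals and apply the semigroup law. This identity links the
    condition [S_plus] to the L^2 norm of the path. *)
Lemma integral_pot_sqr s : (0 < s)%R ->
  \int[L]_y (pot s y * pot s y) = \int[mu]_x \int[mu]_y (kern (2 * s) y x)%:E.
Proof.
move=> s0.
transitivity (\int[L]_y \int[mu]_x ((kern s y x)%:E * pot s y)).
  apply: eq_integral => y _; rewrite ge0_integralZr ?pot_ge0//.
  - exact: measurable_EFin_kernr.
  - by move=> z _; rewrite lee_fin kern_ge0.
rewrite tonelli_swap; last 2 first.
- apply: emeasurable_funM; first exact: measurable_EFin_kern2.
  exact: (measurableT_comp (measurable_pot s)).
- by move=> y z; rewrite mule_ge0 ?pot_ge0// lee_fin kern_ge0.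
apply: eq_integral => z _; rewrite (integral_kern_pot z s0 s0) mulr_natl.
by apply: eq_integral => y _; rewrite kernC.
Qed.

End sigma_finite.

(* Integrate [2 a u <= a^2 + u^2] against [kern t . x] and take [a = m]. *)
Lemma sqr_integral_kern t x (u : E -> \bar R) : (0 < t)%R ->
  measurable_fun setT u -> (forall y, 0 <= u y) ->
  (\int[L]_y ((kern t y x)%:E * u y)) * (\int[L]_y ((kern t y x)%:E * u y)) <=
  \int[L]_y ((kern t y x)%:E * (u y * u y)).
Proof.
move=> t0 mu u0; set m := \int[L]_y _; set q := \int[L]_y _.
have mk := measurable_EFin_kern t x.
have k0 y : 0 <= (kern t y x)%:E by rewrite lee_fin kern_ge0.
have m0 : 0 <= m by apply: integral_ge0 => y _; rewrite mule_ge0.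
have q0 : 0 <= q by apply: integral_ge0 => y _; rewrite !mule_ge0.
have amgm (a : R) : (0 <= a)%R -> (2 * a)%:E * m <= (a * a)%:E + q.
  move=> a0; rewrite /m -ge0_integralZl_EFin ?mulr_ge0//; last 2 first.
  - by move=> y _; rewrite mule_ge0.
  - exact: emeasurable_funM.
  have -> : (a * a)%:E + q =
      \int[L]_y ((a * a)%:E * (kern t y x)%:E + (kern t y x)%:E * (u y * u y)).
    rewrite ge0_integralD//; last 4 first.
    - by move=> y _; rewrite mule_ge0// lee_fin mulr_ge0.
    - exact: emeasurable_funM.
    - by move=> y _; rewrite !mule_ge0.
    - by do 2?apply: emeasurable_funM.
    rewrite ge0_integralZl_EFin ?mulr_ge0//.
    by rewrite integral_kern// mule1.
  apply: ge0_le_integral => //.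
  - by move=> y _; rewrite !mule_ge0// lee_fin mulr_ge0.
  - by do 2?apply: emeasurable_funM.
  - by apply: emeasurable_funD; do 2?apply: emeasurable_funM.
  - move=> y _; rewrite [(a * a)%:E * _]muleC -ge0_muleDr ?mule_ge0 ?lee_fin ?mulr_ge0//.
    rewrite muleCA lee_wpmul2l//; have := u0 y; case: (u y) => [r| |]//.
      by rewrite !lee_fin => r0; have := sqr_ge0 (a - r); nra.
    by move=> _; rewrite mulyy addey// leey.
have := q0; rewrite le_eqVlt => /orP[/eqP q0'|]; last first.
  case: q amgm {q0} => [q| |]//; last by rewrite leey.
  move: m m0 => [m| |]//= m0 amgm q0.
    by have := amgm m m0; rewrite -EFinD -!EFinM !lee_fin; nra.
  (* An infinite [m] is excluded when [q] is finite: already [a = 1] gives a contradiction. *)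
  by have := amgm 1%R ler01; rewrite gt0_muley ?leye_eq// lte_fin mulr1.
rewrite -q0' in amgm *; move: m m0 amgm => [m| |]//= m0 amgm.
  by have := amgm m m0; rewrite -EFinD -!EFinM !lee_fin; nra.
by have := amgm 1%R ler01; rewrite gt0_muley ?leye_eq// lte_fin mulr1.
Qed.

(** Apply the pointwise inequality [sqr_integral_kern], then Tonelli: by symmetry the kernel also
    has mass 1 in [x]. *)
Lemma integral_sqr_le t (u : E -> \bar R) : (0 < t)%R ->
  measurable_fun setT u -> (forall y, 0 <= u y) ->
  \int[L]_x ((\int[L]_y ((kern t y x)%:E * u y)) *
            (\int[L]_y ((kern t y x)%:E * u y))) <= \int[L]_y (u y * u y).
Proof.
move=> t0 mu u0.
have mku : measurable_fun setT (fun p : E * E => (kern t p.2 p.1)%:E * u p.2).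
  under eq_fun do rewrite kernC.
  apply: emeasurable_funM; first exact: measurable_EFin_kern2.
  exact: (measurableT_comp mu).
have mkuu : measurable_fun setT (fun p : E * E => (kern t p.2 p.1)%:E * (u p.2 * u p.2)).
  under eq_fun do rewrite muleA.
  by apply: emeasurable_funM => //; exact: (measurableT_comp mu).
have k0 x y : 0 <= (kern t x y)%:E by rewrite lee_fin kern_ge0.
apply: (@le_trans _ _ (\int[L]_x \int[L]_y ((kern t y x)%:E * (u y * u y)))).
  apply: le_integral_nomeas => x _; last exact: sqr_integral_kern.
  by rewrite mule_ge0//; apply: integral_ge0 => y _; rewrite mule_ge0.
rewrite tonelli_swap//; last by move=> x y; rewrite !mule_ge0.
rewrite le_eqVlt; apply/orP; left; apply/eqP; apply: eq_integral => y _.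
rewrite ge0_integralZr//; last 2 first.
- exact: measurable_EFin_kernr.
- by rewrite mule_ge0.
by under eq_integral do rewrite kernC; rewrite integral_kern// mul1e.
Qed.

(** The potential at [t] is the one at [s] smoothed for time [t - s], and smoothing contracts L^2.
    Finiteness at arbitrarily small times thus spreads to all times. *)
Lemma integral_pot_sqr_mono (mu : {sigma_finite_measure set E -> \bar R}) s t :
  (0 < s)%R -> (s < t)%R -> \int[L]_y (pot mu t y * pot mu t y) <=
  \int[L]_y (pot mu s y * pot mu s y).
Proof.
move=> s0 st; have ts0 : (0 < t - s)%R by rewrite subr_gt0.
have := integral_sqr_le ts0 (measurable_pot mu s) (pot_ge0 mu s).
by under eq_integral do rewrite integral_kern_pot// subrK.
Qed.

End potential.

(** * Limits of measures along an ultrafilter *)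

Section ultralimit.
Context (R : realType) (I : Type) (U : set_system I) (UF : UltraFilter U).

(** Compactness of the segment gives a cluster point [p]. An ultrafilter contains the preimage of a
    neighbourhood of [p] or its complement, and the latter contradicts clustering. *)
Lemma ultra_bounded_cvg (h : I -> R) (M : R) :
  (forall n, 0 <= h n <= M) -> cvg (h n @[n --> U]).
Proof.
move=> hM; have UP : ProperFilter U by exact: ultra_proper.
have [p [_ clp]] : exists p, (`[0, M] `&` cluster (h @ U)) p.
  apply: segment_compact.
  rewrite /fmap/= /nbhs/=; apply: filterE => n /=.
  by rewrite in_itv/=; exact: hM.
apply/cvg_ex; exists p => N Np.
have [//|NU] := in_ultra_setVsetC (h @^-1` N) _.
by have [y []] := clp (~` N) N NU Np.
Qed.

End ultralimit.

(** * Integrals of functions of finitely many bits *)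

Section code_integral.
Context d0 (T : measurableType d0) (R : realType) (D : set T).
Hypothesis mD : measurable D.
Variables (k : nat) (c : T -> seq bool).
Hypothesis size_c : forall y, size (c y) = k.
Hypothesis mc : forall w, measurable [set y | c y = w].

Lemma code_sum (h : seq bool -> R) y :
  h (c y) = \sum_(w : k.-tuple bool) h w * \1_[set y | c y = w] y.
Proof.
have sz : size (c y) == k by rewrite size_c.
rewrite (bigD1 (Tuple sz))//= indicE mem_set// mulr1 big1 ?addr0// => w wc.
rewrite indicE memNset ?mulr0//= => cw; move/eqP: wc; apply.
exact/val_inj/esym.
Qed.

Lemma measurable_code_fun (h : seq bool -> R) : measurable_fun setT (h \o c).
Proof.
under [_ \o _]eq_fun do rewrite code_sum.
by apply: measurable_sum => w; exact: measurable_funM.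
Qed.

Lemma integral_code (m : {measure set T -> \bar R}) (h : seq bool -> R) :
  (forall w, 0 <= h w) ->
  (\int[m]_(y in D) (h (c y))%:E =
   \sum_(w : k.-tuple bool) (h w)%:E * m (D `&` [set y | c y = w]))%E.
Proof.
move=> h0.
transitivity (\int[m]_(y in D)
    \sum_(w : k.-tuple bool) ((h w)%:E * (\1_[set y | c y = w] y)%:E))%E.
  apply: eq_integral => y _; rewrite code_sum -sumEFin.
  by apply: eq_bigr => w _; rewrite EFinM.
rewrite ge0_integral_sum//; last 2 first.
- move=> w; apply: measurable_funTS; apply: emeasurable_funM => //.
  by apply/measurable_EFinP; exact/measurable_indicP.
- by move=> w y _; rewrite mule_ge0 ?lee_fin ?h0.
apply: eq_bigr => w _; rewrite ge0_integralZl_EFin ?h0//; last first.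
  by apply: measurable_funTS; apply/measurable_EFinP; exact/measurable_indicP.
by rewrite integral_indic// setIC.
Qed.

End code_integral.

(** * Uniform perturbation of integrals over a set of finite measure *)

Section uniform_integral.
Context d0 (T : measurableType d0) (R : realType) (D : set T).
Hypothesis mD : measurable D.
Variables (m : {measure set T -> \bar R}) (M : R).
Hypothesis mM : (m D <= M%:E)%E.

Lemma integral_bounded_fin (f : T -> R) (C : R) : (forall y, 0 <= f y <= C) ->
  (\int[m]_(y in D) (f y)%:E)%E \is a fin_num.
Proof.
move=> fC; rewrite ge0_fin_numE; last first.
  by apply: integral_ge0 => y _; rewrite lee_fin; case/andP: (fC y).
apply: (@le_lt_trans _ _ (\int[m]_(y in D) (cst C%:E y))%E).
  by apply: le_integral_nomeas => y _; rewrite lee_fin; case/andP: (fC y).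
have C0 : 0 <= C by case/andP: (fC point) => /le_trans h /h.
rewrite integral_cst// (@le_lt_trans _ _ (C%:E * M%:E)%E)//.
  by rewrite lee_wpmul2l.
by rewrite -EFinM ltry.
Qed.

Lemma integral_dist_le (f g : T -> R) (C e : R) :
  measurable_fun D f -> measurable_fun D g ->
  (forall y, 0 <= f y <= C) -> (forall y, 0 <= g y <= C) -> 0 <= e ->
  (forall y, D y -> `|f y - g y| <= e) ->
  `|fine (\int[m]_(y in D) (f y)%:E) - fine (\int[m]_(y in D) (g y)%:E)|
    <= e * M.
Proof.
move=> mf mg fC gC e0 fg.
have half (p q : T -> R) : measurable_fun D q ->
    (forall y, 0 <= p y <= C) -> (forall y, 0 <= q y <= C) ->
    (forall y, D y -> `|p y - q y| <= e) ->
    fine (\int[m]_(y in D) (p y)%:E) <= fine (\int[m]_(y in D) (q y)%:E) + e * M.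
  move=> mq pC qC pq.
  rewrite -lee_fin EFinD !fineK ?(integral_bounded_fin pC) ?(integral_bounded_fin qC)//.
  apply: (@le_trans _ _ (\int[m]_(y in D) ((q y)%:E + e%:E))%E).
    apply: le_integral_nomeas => y Dy; first by rewrite lee_fin; case/andP: (pC y).
    rewrite -EFinD lee_fin -lerBlDl; apply: le_trans (pq _ Dy).
    exact: ler_norm.
  rewrite ge0_integralD//; last 2 first.
  - by move=> y _; rewrite lee_fin; case/andP: (qC y).
  - exact/measurable_EFinP.
  by rewrite leeD2l// integral_cst// EFinM lee_wpmul2l.
rewrite ler_norml lerBlDl lerBrDr.
apply/andP; split; last exact: half.
rewrite addrC lerBlDr.
by apply: half => // y Dy; rewrite distrC; exact: fg.
Qed.

End uniform_integral.

(** * Limit masses of bit patterns and nested intervals *)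

Section tree.
Context d0 (T : measurableType d0) (R : realType).
Variable b : nat -> T -> bool.
Hypothesis mb : forall k, measurable [set y | b k y].

(* The most recent bit comes first. *)
Fixpoint code (k : nat) (y : T) : seq bool :=
  if k is j.+1 then b j y :: code j y else [::].

Lemma size_code k y : size (code k y) = k.
Proof. by elim: k => //= k ->. Qed.

Lemma code_drop k l y : (k <= l)%N -> code k y = drop (l - k) (code l y).
Proof.
elim: l => [|l IH]; first by rewrite leqn0 => /eqP ->.
by rewrite leq_eqVlt => /predU1P[->|kl]; rewrite ?subnn ?drop0// subSn// IH.
Qed.

Lemma measurable_code k w : measurable [set y | code k y = w].
Proof.
elim: k w => [|k IH] w /=.
  have [->|w0] := eqVneq w [::].
    by rewrite (_ : [set _ | _] = setT)//; apply/seteqP; split.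
  rewrite (_ : [set _ | _] = set0)//; apply/seteqP; split => // y /= w00.
  by rewrite -w00 eqxx in w0.
case: w => [|c w].
  by rewrite (_ : [set _ | _] = set0)//; apply/seteqP; split.
rewrite (_ : [set _ | _] = [set y | b k y = c] `&` [set y | code k y = w]).
  apply: measurableI => //; case: c; first exact: mb.
  rewrite (_ : [set _ | _] = ~` [set y | b k y]); first exact: measurableC.
  by apply/seteqP; split => y /=; case: (b k y).
by apply/seteqP; split => y /= [-> ->].
Qed.

Variables (nu : nat -> {measure set T -> \bar R}) (M : R).
Hypothesis nuM : forall n, (nu n setT <= M%:E)%E.
Variables (U : set_system nat) (UF : UltraFilter U).
Let UP : ProperFilter U := @ultra_proper _ _ UF.
Local Existing Instance UP.

Definition cell w := [set y | code (size w) y = w].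

Definition mass n w : R := fine (nu n (cell w)).

Definition wt w : R := lim (mass n w @[n --> U]).

Lemma cell_fin n A : measurable A -> nu n A \is a fin_num.
Proof.
move=> mA; rewrite ge0_fin_numE// (le_lt_trans _ (ltry M))//.
by apply: le_trans (nuM n); rewrite le_measure ?inE.
Qed.

Lemma measurable_cell w : measurable (cell w).
Proof. exact: measurable_code. Qed.

Lemma mass_bounds n w : 0 <= mass n w <= M.
Proof.
rewrite fine_ge0//= -lee_fin fineK ?cell_fin//; last exact: measurable_cell.
by apply: le_trans (nuM n); rewrite le_measure ?inE//; exact: measurable_cell.
Qed.

Lemma wt_cvg w : mass n w @[n --> U] --> wt w.
Proof. exact: (ultra_bounded_cvg UF (mass_bounds ^~ w)). Qed.

Lemma wt_ge0 w : 0 <= wt w.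
Proof.
apply: limr_ge; first exact: wt_cvg.
by apply: nearW => n; case/andP: (mass_bounds n w).
Qed.

Lemma wt_le w : wt w <= M.
Proof.
apply: limr_le; first exact: wt_cvg.
by apply: nearW => n; case/andP: (mass_bounds n w).
Qed.

(** The next bit splits the cell of [w] in two, and limits along one filter respect sums. This
    additivity lets the intervals of the two children tile that of the parent. *)
Lemma wtD w : wt w = wt (false :: w) + wt (true :: w).
Proof.
apply: cvg_lim => //.
rewrite (_ : mass^~ w = fun n => mass n (false :: w) + mass n (true :: w)).
  by apply: cvgD; exact: wt_cvg.
apply/funext => n; rewrite /mass -fineD ?cell_fin//; try exact: measurable_cell.
rewrite -measureU//; try exact: measurable_cell.
  congr (fine (nu n _)); apply/seteqP; split => y; rewrite /cell/=.
    by case: (b (size w) y) => ->; [right|left].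
  by case=> -[].
by apply/seteqP; split => // y [] [bf _] []; rewrite bf.
Qed.

(** Guarantees that a word of positive weight is the code of an actual point. *)
Lemma wt_empty w : cell w = set0 -> wt w = 0.
Proof.
move=> w0; apply/cvg_lim => //.
rewrite (_ : mass^~ w = cst 0); first exact: cvg_cst.
by apply/funext => n; rewrite /mass w0 measure0.
Qed.

(* [[left w, left w + wt w[] is the interval allotted to the cell of [w]. *)
Fixpoint left (w : seq bool) : R :=
  if w is c :: v then left v + (if c then wt (false :: v) else 0) else 0.

(** Descends the tree of intervals towards [u]: the [false] child has the left part of its parent's
    interval, the [true] child the rest. *)
Fixpoint branch (k : nat) (u : R) : seq bool :=
  if k is j.+1 then
    let w := branch j u in (left w + wt (false :: w) <= u) :: w
  else [::].

Lemma size_branch k u : size (branch k u) = k.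
Proof. by elim: k => //= k ->. Qed.

Lemma branch_drop k l u : (k <= l)%N -> branch k u = drop (l - k) (branch l u).
Proof.
elim: l => [|l IH]; first by rewrite leqn0 => /eqP ->.
by rewrite leq_eqVlt => /predU1P[->|kl]; rewrite ?subnn ?drop0// subSn// IH.
Qed.

Lemma measurable_branch k w :
  measurable ([set u | branch k u = w] : set (measurableTypeR R)).
Proof.
elim: k w => [|k IH] w /=.
  have [->|w0] := eqVneq w [::].
    by rewrite (_ : [set _ | _] = setT)//; apply/seteqP; split.
  rewrite (_ : [set _ | _] = set0)//; apply/seteqP; split => // y /= w00.
  by rewrite -w00 eqxx in w0.
case: w => [|c w].
  by rewrite (_ : [set _ | _] = set0)//; apply/seteqP; split.
rewrite (_ : [set _ | _] =
  [set u | (left w + wt (false :: w) <= u) = c] `&` [set u | branch k u = w]).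
  apply: measurableI => //.
  rewrite (_ : [set _ | _] = if c then `[left w + wt (false :: w), +oo[%classic
    else ~` `[left w + wt (false :: w), +oo[%classic).
    by case: c; [|apply: measurableC]; exact: measurable_itv.
  apply/seteqP; case: c; split => u /=; rewrite in_itv/= andbT//.
    by move=> ->.
  by move/negP/negbTE.
by apply/seteqP; split => u /= [<- <-].
Qed.

Lemma branch_spec k u : 0 <= u < wt [::] ->
  left (branch k u) <= u < left (branch k u) + wt (branch k u).
Proof.
move=> u0; elim: k => [|k /= /andP[IHl IHr]]; first by rewrite /= add0r.
set w := branch k u in IHl IHr *; have wD := wtD w.
have [h|h] := leP (left w + wt (false :: w)) u; last by rewrite addr0 IHl h.
by rewrite h/= -addrA -wD.
Qed.

(** Together with [branch_spec], this makes the intervals of the words of a given length a partition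
    of [[0, wt [::][]. *)
Lemma branch_uniq w u : left w <= u < left w + wt w ->
  0 <= u < wt [::] /\ branch (size w) u = w.
Proof.
elim: w => [|c w IH]; first by rewrite /= add0r.
move=> /= /andP[wl wr].
have [|u0 wE] := IH.
  have f0 := wt_ge0 (false :: w); have t0 := wt_ge0 (true :: w).
  by rewrite (wtD w); case: c wl wr => wl wr; apply/andP; split; lra.
split => //; rewrite wE; congr (_ :: _).
by case: c wl wr => [-> //|_]; rewrite addr0 leNgt => ->.
Qed.

Let D : set (measurableTypeR R) := `[0, wt [::][%classic.

Lemma measure_branch k w : size w = k ->
  lebesgue_measure (D `&` [set u | branch k u = w]) = (wt w)%:E.
Proof.
move=> wk; rewrite (_ : _ `&` _ = `[left w, left w + wt w[%classic).
  rewrite lebesgue_measure_itv/= lte_fin ltrDl -EFinD addrAC subrr add0r.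
  (* A word of weight 0 has an empty interval, a separate case of the length formula. *)
  by have := wt_ge0 w; rewrite le_eqVlt => /predU1P[<-|->]//; rewrite ltxx.
apply/seteqP; split => u /=; rewrite !in_itv/=.
  by move=> [u0 <-]; exact: branch_spec.
by move=> /branch_uniq[u0 <-]; rewrite wk.
Qed.

(** The default [point] arises only for an empty cell, whose weight is 0. *)
Definition pt w : T := xget point (cell w).

Lemma code_pt k y : code k (pt (code k y)) = code k y.
Proof.
have : cell (code k y) (pt (code k y)).
  by rewrite /pt; case: xgetP => // /(_ y); rewrite /cell/= size_code.
by rewrite /cell/= size_code.
Qed.

(** The interval that contains [u] has positive weight, so its cell is inhabited and [pt] lies in
    it; the first [k] of its [l] bits are those of [branch k u]. *)
Lemma code_branch k l u : D u -> (k <= l)%N ->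
  code k (pt (branch l u)) = branch k u.
Proof.
rewrite /D/= in_itv/= => u0 kl.
have cl : code l (pt (branch l u)) = branch l u.
  have : cell (branch l u) (pt (branch l u)).
    rewrite /pt; case: xgetP => // no; exfalso.
    have /wt_empty w0 : cell (branch l u) = set0.
      by apply/seteqP; split => // y; exact: no.
    by have := branch_spec l u0; rewrite w0; lra.
  by rewrite /cell/= size_branch.
by rewrite (code_drop _ kl) cl -branch_drop.
Qed.

(** * Convergence of integrals along the ultrafilter *)

Section limit.
Variables (f : T -> R) (F : measurableTypeR R -> R) (C : R).
Hypotheses (mf : measurable_fun setT f) (mF : measurable_fun D F).
Hypotheses (fC : forall y, 0 <= f y <= C) (FC : forall u, 0 <= F u <= C).
Hypothesis f_osc : forall e, 0 < e ->
  exists k, forall y z, code k y = code k z -> `|f y - f z| <= e.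
Hypothesis fF : forall u, D u -> f (pt (branch k u)) @[k --> \oo] --> F u.

Let gC w : 0 <= f (pt w) <= C. Proof. exact: fC. Qed.

Let mD : measurable D. Proof. exact: measurable_itv. Qed.

Let lebD : (@lebesgue_measure R D <= M%:E)%E.
Proof.
rewrite lebesgue_measure_itv/= lte_fin; case: ifP => _.
  by rewrite -EFinD subr0 lee_fin wt_le.
by rewrite lee_fin (le_trans (wt_ge0 [::]))// wt_le.
Qed.

Let sum_mass k n : fine (\int[nu n]_y (f (pt (code k y)))%:E)%E =
  \sum_(w : k.-tuple bool) f (pt w) * mass n w.
Proof.
rewrite (integral_code measurableT (size_code k) (@measurable_code k) (nu n)
  (h := f \o pt)); last by move=> w; case/andP: (gC w).
rewrite -[RHS]/(fine (_%:E)) -sumEFin; congr fine; apply: eq_bigr => w _.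
by rewrite EFinM setTI /mass fineK ?cell_fin//; last exact: measurable_cell;
  rewrite /cell size_tuple.
Qed.

Let sum_wt k :
  fine (\int[lebesgue_measure]_(u in D) (f (pt (branch k u)))%:E)%E =
  \sum_(w : k.-tuple bool) f (pt w) * wt w.
Proof.
rewrite (integral_code mD (size_branch k) (measurable_branch k)
  (@lebesgue_measure R) (h := f \o pt)); last by move=> w; case/andP: (gC w).
rewrite -[RHS]/(fine (_%:E)) -sumEFin; congr fine; apply: eq_bigr => w _.
by rewrite EFinM -(@measure_branch k)// size_tuple.
Qed.

(** At depth [k] both integrals become finite sums over words, which converge since every cell mass
    does. Small oscillation of [f] on cells makes the replacement uniformly cheap on both sides. *)
Lemma ultralimit_integral :
  (\int[nu n]_y (f y)%:E)%E @[n --> U] -->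
  (\int[lebesgue_measure]_(u in D) (F u)%:E)%E.
Proof.
rewrite -(fineK (integral_bounded_fin mD lebD FC)).
apply: cvg_EFin.
  by apply: nearW => n; exact: integral_bounded_fin (nuM n) _ _ fC.
apply/cvgrPdist_le => e e0.
have M0 : 0 <= M by apply: le_trans (wt_le [::]); exact: wt_ge0.
have M1 : 0 < 2 * M + 1 by lra.
(* The errors [dl * M], [dl] and [dl * M] below add up to [e]. *)
pose dl := e / (2 * M + 1); have dl0 : 0 < dl by rewrite divr_gt0.
have [k osc] := f_osc dl0.
have Sk : \sum_(w : k.-tuple bool) f (pt w) * mass n w @[n --> U] -->
    \sum_(w : k.-tuple bool) f (pt w) * wt w.
  apply: cvg_big => [|w _]; first exact: add_continuous.
  by apply: cvgM; [exact: cvg_cst|exact: wt_cvg].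
move/cvgrPdist_le : Sk => /(_ _ dl0); apply: filterS => n.
rewrite -sum_mass -sum_wt => h2.
have h1 : `|fine (\int[lebesgue_measure]_(u in D) (F u)%:E)%E -
    fine (\int[lebesgue_measure]_(u in D) (f (pt (branch k u)))%:E)%E| <= dl * M.
  apply: (integral_dist_le mD lebD (C := C)) => //.
  - apply: measurable_funTS.
    exact: (measurable_code_fun (size_branch k) (measurable_branch k) (f \o pt)).
  - exact: ltW.
  - move=> u Du; rewrite distrC.
    (* The representatives at depths [k] and [l >= k] share their first [k] bits; let [l] tend to
       infinity in the oscillation bound. *)
    have c : `|f (pt (branch k u)) - f (pt (branch l u))| @[l --> \oo] -->
        `|f (pt (branch k u)) - F u|.
      by apply: cvg_norm; apply: cvgB; [exact: cvg_cst|exact: fF].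
    rewrite -(cvg_lim _ c)//; apply: limr_le; first exact: cvgP c.
    by exists k => // l /= kl; apply: osc; rewrite !code_branch.
have h3 : `|fine (\int[nu n]_y (f (pt (code k y)))%:E)%E -
    fine (\int[nu n]_y (f y)%:E)%E| <= dl * M.
  apply: (integral_dist_le measurableT (nuM n) (C := C)) => //.
  - exact: (measurable_code_fun (size_code k) (@measurable_code k) (f \o pt)).
  - exact: ltW.
  - by move=> y _; apply: osc; rewrite code_pt.
rewrite -(subrKA (fine (\int[lebesgue_measure]_(u in D) (f (pt (branch k u)))%:E)%E)).
rewrite (le_trans (ler_normD _ _))//.
rewrite -[X in _ + `|X|](subrKA (fine (\int[nu n]_y (f (pt (code k y)))%:E)%E)).
apply: (le_trans (lerD h1 (le_trans (ler_normD _ _) (lerD h2 h3)))).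
have -> : e = dl * (2 * M + 1) by rewrite divfK// gt_eqF.
by rewrite le_eqVlt; apply/orP; left; apply/eqP; ring.
Qed.

End limit.

End tree.

(** * Densities and orthants *)

Section density.
Context d0 (T : measurableType d0) (R : realType).
Local Open Scope ereal_scope.
Import HBNNSimple.

(** Monotone convergence on both sides reduces to simple functions, then linearity to indicators,
    where it is the assumption on [n]. *)
Lemma integral_density (m n : {measure set T -> \bar R}) (rho : T -> R)
    (h : T -> \bar R) :
  measurable_fun setT rho -> (forall y, 0 <= rho y)%R ->
  (forall A, measurable A -> n A = \int[m]_(y in A) (rho y)%:E) ->
  measurable_fun setT h -> (forall y, 0 <= h y) ->
  \int[n]_y h y = \int[m]_y (h y * (rho y)%:E).
Proof.
move=> mrho rho0 nE mh h0.
have mr : measurable_fun setT (fun y => (rho y)%:E) by exact/measurable_EFinP.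
pose f_ := nnsfun_approx measurableT mh.
have fh y : (f_ k y)%:E @[k --> \oo] --> h y.
  by apply: cvg_nnsfun_approx => // x _; exact: h0.
have mf k : measurable_fun setT (fun y => (f_ k y)%:E) by exact/measurable_EFinP.
have fnd y i j : (i <= j)%N -> (f_ i y <= f_ j y)%R.
  by move=> ij; exact/lefP/nd_nnsfun_approx.
transitivity (limn (fun k => \int[n]_y (f_ k y)%:E)).
  rewrite -monotone_convergence//.
  - by apply: eq_integral => y _; apply/esym/cvg_lim => //; exact: fh.
  - by move=> k y _; rewrite lee_fin.
  - by move=> y _ i j ij; rewrite lee_fin fnd.
transitivity (limn (fun k => \int[m]_y ((f_ k y)%:E * (rho y)%:E))); last first.
  rewrite -monotone_convergence//.
  - apply: eq_integral => y _; apply/cvg_lim => //.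
    by apply: cvgeZr => //; exact: fh.
  - by move=> k; exact: emeasurable_funM.
  - by move=> k y _; rewrite mule_ge0// lee_fin.
  - by move=> y _ i j ij; rewrite lee_wpmul2r ?lee_fin ?fnd.
congr (limn _); apply/funext => k.
rewrite integralT_nnsfun sintegralE.
transitivity (\int[m]_y
    (\sum_(r \in range (f_ k)) ((r * \1_(f_ k @^-1` [set r]) y)%:E * (rho y)%:E))).
  rewrite ge0_integral_fsum//; last 2 first.
  - move=> r; apply: emeasurable_funM => //; apply/measurable_EFinP.
    exact: measurable_funM.
  - move=> r y _; rewrite mule_ge0 ?lee_fin//.
    by rewrite -lee_fin EFinM nnfun_muleindic_ge0.
  apply: eq_fsbigr => r /[!inE] -[y0 _ <-{r}].
  rewrite nE//; under [RHS]eq_integral do rewrite EFinM -muleA.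
  rewrite ge0_integralZl_EFin//; last 2 first.
  - by move=> y _; rewrite mule_ge0 ?lee_fin.
  - by apply: emeasurable_funM => //; apply/measurable_EFinP.
  congr (_ * _); rewrite integral_mkcond; apply: eq_integral => y _.
  by rewrite epatch_indic muleC.
apply: eq_integral => y _; rewrite fimfunE -fsumEFin//.
by rewrite ge0_mule_fsuml// => r; rewrite EFinM nnfun_muleindic_ge0.
Qed.

Lemma density_exists (m : {measure set T -> \bar R}) (rho : T -> R) :
  measurable_fun setT rho -> (forall y, 0 <= rho y)%R ->
  exists n : {measure set T -> \bar R},
    forall A, measurable A -> n A = \int[m]_(y in A) (rho y)%:E.
Proof.
move=> mrho rho0.
pose n (A : set T) := \int[m]_(y in A) (rho y)%:E.
have n0 : n set0 = 0 by rewrite /n integral_set0.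
have nge0 A : 0 <= n A by apply: integral_ge0 => y _; rewrite lee_fin.
have nadd : semi_sigma_additive n.
  move=> A mA tA mUA; rewrite /n ge0_integral_bigcup//; last 2 first.
  - by apply: measurable_funTS; exact/measurable_EFinP.
  - by move=> y _; rewrite lee_fin.
  by apply: is_cvg_ereal_nneg_natsum_cond => k _ _; exact: nge0.
pose H := isMeasure.Build _ _ _ n n0 nge0 nadd.
pose n' : {measure set T -> \bar R} := HB.pack n H.
by exists n'.
Qed.

End density.

(** * Lipschitz approximation of open rays *)

Section ramp.
Context (R : realType).

(** Exchange the factors one at a time; the remaining ones have modulus at most 1. *)
Lemma prod_dist_le (d : nat) (p q : 'I_d -> R) :
  (forall i, 0 <= p i <= 1) -> (forall i, 0 <= q i <= 1) ->
  `|\prod_i p i - \prod_i q i| <= \sum_i `|p i - q i|.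
Proof.
elim: d p q => [|d IH] p q p01 q01; first by rewrite !big_ord0 subrr normr0.
rewrite !big_ord_recl; set P := \prod_(i < d) _; set Q := \prod_(i < d) q _.
have -> : p ord0 * P - q ord0 * Q = (p ord0 - q ord0) * P + q ord0 * (P - Q) by ring.
rewrite (le_trans (ler_normD _ _))// !normrM lerD//.
  rewrite ler_piMr// ger0_norm; last first.
    by apply: prodr_ge0 => i _; case/andP: (p01 (lift ord0 i)).
  by apply: prodr_ile1 => i _; exact: p01.
have /andP[q0 q1] := q01 ord0; rewrite (ger0_norm q0).
apply: le_trans (IH _ _ (fun i => p01 _) (fun i => q01 _)).
by rewrite ler_piMl.
Qed.

(** [None] leaves a coordinate free, so that the whole space and half-spaces also count as
    orthants. *)
Definition ray (o : option R) : set R := if o is Some a then `]a, +oo[ else setT.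

(** Vanishes up to [a] and rises to 1 with slope [n]; the limit at [a] itself is 0, which is why
    rays are open. *)
Definition ramp (o : option R) (n : nat) (v : R) : R :=
  if o is Some a then Num.min 1 (n%:R * Num.max 0 (v - a)) else 1.

Lemma ramp_bounds o n v : 0 <= ramp o n v <= 1.
Proof.
case: o => [a|]/=; last by rewrite ler01 lexx.
by rewrite le_min ler01 mulr_ge0 ?le_max ?lexx//= ge_min lexx.
Qed.

Lemma ramp_le o i j v : (i <= j)%N -> ramp o i v <= ramp o j v.
Proof.
case: o => //= a ij; rewrite le_min !ge_min lexx/=; apply/orP; right.
by rewrite ler_wpM2r ?ler_nat// le_max lexx.
Qed.

Lemma ramp_lip o n v w : `|ramp o n v - ramp o n w| <= n%:R * `|v - w|.
Proof.
case: o => [a|]/=; last by rewrite subrr normr0 mulr_ge0.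
have n0 : 0 <= n%:R :> R by [].
have M : `|Num.max 0 (v - a) - Num.max 0 (w - a)| <= `|v - w|.
  by rewrite /Num.max; case: ifPn; case: ifPn; rewrite -?leNgt !ler_norml;
    case: (ler0P (v - w)); lra.
apply: le_trans (ler_wpM2l n0 M); rewrite -[X in _ <= X * _](ger0_norm n0) -normrM mulrBr.
set x := n%:R * _; set y := n%:R * _.
by rewrite /Num.min; case: ifPn; case: ifPn; rewrite -?leNgt !ler_norml;
    case: (ler0P (x - y)); lra.
Qed.

Lemma measurable_ramp o n : measurable_fun setT (ramp o n).
Proof.
case: o => [a|]; last exact: measurable_cst.
apply: measurable_minr => //; apply: measurable_funM => //.
by apply: measurable_maxr => //; exact: measurable_funB.
Qed.

Lemma ramp_cvg o v : ramp o n v @[n --> \oo] --> (\1_(ray o) v : R).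
Proof.
case: o => [a|]; last by rewrite indicT; exact: cvg_cst.
rewrite /ramp/=; have [av|va] := ltP a v; last first.
  rewrite indicE memNset; last by rewrite /= in_itv/= andbT; apply/negP; rewrite -leNgt.
  under eq_fun do rewrite max_l ?subr_le0// mulr0 min_r ?ler01//.
  exact: cvg_cst.
rewrite indicE mem_set /=; last by rewrite in_itv/= av.
have va0 : 0 < v - a by rewrite subr_gt0.
apply: cvg_near_cst; near=> n.
rewrite max_r ?ltW// min_l// -ler_pdivrMr// div1r.
by near: n; exact: nbhs_infty_ger.
Unshelve. all: by end_near. Qed.

End ramp.

(** * Open orthants as a generating pi-system *)

Section orthant.
Context (R : realType) (d : nat).
Notation E := (euclid R d).

Definition orthant (o : 'I_d -> option R) : set E :=
  [set y | forall i, ray (o i) (tnth y i)].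

Definition orthants : set (set E) := [set orthant o | o in setT].

Lemma measurable_orthant o : measurable (orthant o).
Proof.
rewrite (_ : orthant o = \bigcap_(i in [set: 'I_d])
    ((@tnth d _ ^~ i) @^-1` ray (o i))).
  apply: fin_bigcap_measurable => // i _.
  rewrite -[X in measurable X]setTI; apply: measurable_tnth => //.
  by rewrite /ray; case: (o i) => [a|]; [exact: measurable_itv|exact: measurableT].
by apply/seteqP; split=> x h i; [move=> _; exact: h|exact: h].
Qed.

Lemma setI_closed_orthants : setI_closed orthants.
Proof.
move=> _ _ [/= o _ <-] [/= p _ <-].
exists (fun i => if o i is Some a then
   (if p i is Some b then Some (Num.max a b) else Some a) else p i) => //.
apply/seteqP; split=> [y oy|y [oy py] i].
  split=> i; have := oy i; rewrite /ray; case: (o i) => [a|]; case: (p i) => [c|]//=;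
    by rewrite !in_itv/= !andbT gt_max => /andP[].
have := oy i; have := py i; rewrite /ray; case: (o i) => [a|]; case: (p i) => [c|]//=.
by rewrite !in_itv/= !andbT gt_max => -> ->.
Qed.

(** It suffices that every coordinate is measurable for the generated sigma-algebra; the preimage of
    an open ray under a coordinate is an orthant with one constraint. *)
Lemma measurable_orthants (A : set E) : measurable A -> <<s orthants >> A.
Proof.
have mid : measurable_fun setT (id : g_sigma_algebraType orthants -> E).
  apply/measurable_fun_tnthP => i /=.
  have := @measurability _ _ (g_sigma_algebraType orthants) (measurableTypeR R)
    setT ((@tnth d _ ^~ i) \o id) _ (RGenOInfty.measurableE R).
  apply=> _ [_ [a ->] <-]; rewrite setTI.
  apply: sub_sigma_algebra.
  exists (fun j => if j == i then Some a else None) => //.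
  apply/seteqP; split=> [y /(_ i)|y yi j]; first by rewrite eqxx.
  by rewrite /ray; case: eqP => // ->.
by move=> mA; have := mid measurableT A mA; rewrite setTI.
Qed.

Definition bump o n (y : E) : R := \prod_(i < d) ramp (o i) n (tnth y i).

Lemma bump_bounds o n y : 0 <= bump o n y <= 1.
Proof.
apply/andP; split.
  by apply: prodr_ge0 => i _; case/andP: (ramp_bounds (o i) n (tnth y i)).
by apply: prodr_ile1 => i _; exact: ramp_bounds.
Qed.

Lemma measurable_bump o n : measurable_fun setT (bump o n).
Proof.
apply: (measurable_prod_coord (f := fun i => ramp (o i) n)) => i.
exact: measurable_ramp.
Qed.

Lemma bump_le o i j y : (i <= j)%N -> bump o i y <= bump o j y.
Proof.
move=> ij; apply: ler_prod => k _; rewrite ramp_le// andbT.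
by case/andP: (ramp_bounds (o k) i (tnth y k)).
Qed.

(** Each of the [d] factors varies by at most [n] times a coordinate difference, which the Euclidean
    distance bounds. *)
Lemma bump_lip o n y z : bump o n y <= bump o n z +
  (d%:R * n%:R) * Num.sqrt (sqdist y z).
Proof.
rewrite -lerBlDl (le_trans (ler_norm _))//.
apply: le_trans (prod_dist_le _ _) _ => [i|i|]; try exact: ramp_bounds.
rewrite -mulrA mulr_natl.
have -> (q : R) : q *+ d = \sum_(i < d) q by rewrite sumr_const card_ord.
apply: ler_sum => i _.
apply: le_trans (ramp_lip _ _ _ _) _; rewrite ler_wpM2l//.
rewrite -sqrtr_sqr ler_wsqrtr// /sqdist (bigD1 i)//= lerDl.
by apply: sumr_ge0 => j _; rewrite sqr_ge0.
Qed.

Lemma bump_cvg o y : bump o n y @[n --> \oo] --> (\1_(orthant o) y : R).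
Proof.
have -> : \1_(orthant o) y = \prod_(i < d) (\1_(ray (o i)) (tnth y i) : R).
  have [oy|noy] := pselect (orthant o y).
    by rewrite indicE mem_set// big1// => i _; rewrite indicE mem_set//; exact: oy.
  rewrite indicE memNset//; move/existsNP: noy => [i ni].
  by rewrite (bigD1 i)//= indicE memNset// mul0r.
apply: cvg_big => [|i _]; first exact: mul_continuous.
exact: ramp_cvg.
Qed.

End orthant.

(** * From measures to entrance paths *)

Section Lspace2.
Context (R : realType) (d : nat).
Notation E := (euclid R d).
Notation L := (lebesgue_euclid R d).
Local Open Scope ereal_scope.

Lemma Lnorm2_sqr (f : E -> R) :
  'N[L]_2%:E[EFin \o f] ^+ 2 = \int[L]_y (f y * f y)%:E.
Proof.
have h (x : \bar R) : 0 <= x -> x ^+ 2 = x `^ 2.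
  case: x => [r| |]// r0; last by rewrite poweRyr// expe2 mulyy.
  by rewrite poweR_EFin powR_mulrn// expe2 -EFinM.
rewrite h ?Lnorm_ge0// poweR_Lnorm//; apply: eq_integral => y _.
by rewrite -h ?abse_ge0// expe2 /= -EFinM -normrM ger0_norm// -expr2 sqr_ge0.
Qed.

(** An element is a quotient class with a proof of finite norm: the classes agree by the quotient
    relation, the proofs by irrelevance. *)
Lemma L2_eqP (x y : L2 R d) : x = y %[ae L] -> x = y.
Proof.
case: x => x [[hx]]; case: y => y [[hy]] /= xy.
have exy : x = y.
  by apply/eqP; rewrite -[x]reprK -[y]reprK; apply/eqP/eqmodP/asboolP.
by subst y; rewrite (Prop_irrelevance hx hy).
Qed.

Lemma measurable_repr (q : {mfun_ L, E >-> measurableTypeR R}) :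
  measurable_fun setT (q : E -> R).
Proof. exact: (measurable_funP (repr q)). Qed.

Lemma L2_of_fun (f : E -> R) : measurable_fun setT f ->
  \int[L]_y (f y * f y)%:E < +oo -> exists g : L2 R d, g = f %[ae L].
Proof.
move=> mf ffin.
have mf' : measurable_fun setT (f : E -> measurableTypeR R) by exact: mf.
pose mfH := isMeasurableFun.Build _ _ _ _ _ mf'.
pose f' : {mfun E >-> measurableTypeR R} := HB.pack f mfH.
pose q : {mfun_ L, E >-> measurableTypeR R} :=
  (\pi_{mfun_ L, E >-> measurableTypeR R} f')%qT.
(* The representative chosen for the class may differ from [f], but only on a null set. *)
have qf : (q : E -> R) = f %[ae L].
  have : repr q = f' %[mod {mfun_ L, E >-> measurableTypeR R}]%qT by rewrite reprK.
  by move/eqmodP/asboolP.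
have qfin : finite_norm L 2%:E (q : E -> R).
  have qq : \int[L]_y (q y * q y)%:E < +oo.
    rewrite (ge0_ae_eq_integral _ _ _ _ _ (g := fun y => (f y * f y)%:E))//.
    - by apply/measurable_EFinP; apply: measurable_funM => //; exact: measurable_repr.
    - by apply/measurable_EFinP; exact: measurable_funM.
    - by move=> y _; rewrite lee_fin -expr2 sqr_ge0.
    - by move=> y _; rewrite lee_fin -expr2 sqr_ge0.
    - by move: qf; apply: filterS => y /= /[apply] ->.
  rewrite /finite_norm -Lnorm2_sqr in qq *.
  apply: contraT; rewrite -leNgt leye_eq => /eqP oo.
  by rewrite oo expe2 mulyy in qq.
pose H := isFinLebesgue.Build _ _ _ L 2%:E (lee1n 2) q qfin.
pose g : L2 R d := HB.pack q H.
by exists g.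
Qed.

End Lspace2.

(** * The entrance path of a measure *)

Section S_plus_to_path.
Context (R : realType) (d : nat).
Notation E := (euclid R d).
Notation L := (lebesgue_euclid R d).
Local Open Scope ereal_scope.

(** If the energy were infinite on all of []0, min l e[], its integral over time would be infinite.
    The comparison avoids measurability, as [mu] is not yet known to be sigma-finite. *)
Lemma S_plus_small (mu : {measure set E -> \bar R}) : S_plus mu ->
  forall e : R, (0 < e)%R -> exists s : R, [/\ (0 < s)%R, (s < e)%R &
    \int[mu]_x \int[mu]_y (kern (2 * s) y x)%:E < +oo].
Proof.
move=> [l l0 fin] e e0; apply: contrapT => no.
pose m := Num.min l e; have m0 : (0 < m)%R by rewrite lt_min l0.
suff : \int[lebesgue_measure]_(s in `]0%R, m[) (cst +oo s) = +oo :> \bar R.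
  move=> ioo; move: fin; apply/negP; rewrite -leNgt -ioo integral_mkcond.
  rewrite [leRHS]integral_mkcond; apply: le_integral_nomeas => s _.
    by apply: erestrict_ge0 => ? _; exact: leey.
  rewrite !patchE; case: ifPn => [|_].
    rewrite inE/= in_itv/= lt_min => /and3P[s0 sl se].
    rewrite mem_set/=; last by rewrite in_itv/= s0.
    rewrite leye_eq; apply/eqP; apply: contrapT => foo; apply: no; exists s.
    by split=> //; rewrite ltey; exact/eqP.
  case: ifPn => // _; apply: integral_ge0 => x _; apply: integral_ge0 => y _.
  by rewrite lee_fin kern_ge0.
have lm : lebesgue_measure `]0%R, m[%classic = m%:E :> \bar R.
  by rewrite lebesgue_measure_itv/= lte_fin m0 oppr0 adde0.
rewrite integral_cst; last exact: measurable_itv.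
by rewrite [X in _ * X]lm gt0_mulye// lte_fin.
Qed.

(** One finite inner integral suffices by [kern_sigma_finite]. If instead the inner integral is
    infinite everywhere, infinite total mass would make the double integral infinite, so [mu] is
    finite. *)
Lemma S_plus_sigma_finite (mu : {measure set E -> \bar R}) :
  S_plus mu -> sigma_finite setT mu.
Proof.
move=> /S_plus_small/(_ 1%R ltr01)[s [s0 _ fin]].
have s20 : (0 < 2 * s)%R by rewrite mulr_gt0.
have [[x xfin]|no] :=
    pselect (exists x, \int[mu]_y (kern (2 * s) x y)%:E < +oo).
  exact: (kern_sigma_finite s20 xfin).
have muT : mu setT < +oo.
  rewrite ltNge leye_eq; apply/negP => /eqP muoo.
  suff oo : \int[mu]_x \int[mu]_y (kern (2 * s) y x)%:E = +oo by rewrite oo in fin.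
  apply/eqP; rewrite -leye_eq.
  apply: (@le_trans _ _ (\int[mu]_x (cst +oo x))).
    by rewrite integral_cst// muoo mulyy.
  apply: le_integral_nomeas => x _; first exact: leey.
  rewrite leye_eq; apply/eqP; apply: contrapT => foo; apply: no; exists x.
  by under eq_integral do rewrite kernC; rewrite ltey; exact/eqP.
by exists (fun=> setT) => //; rewrite bigcup_const.
Qed.

Lemma Lnorm_represents (nu : {sigma_finite_measure set E -> \bar R})
    (g : L2 R d) (s : R) : (0 < s)%R -> EFin \o g = pot nu s %[ae L] ->
  'N[L]_2%:E[EFin \o g] ^+ 2 =
  \int[nu]_x \int[nu]_y (kern (2 * s) y x)%:E.
Proof.
move=> s0 gE; rewrite Lnorm2_sqr.
rewrite (ge0_ae_eq_integral _ _ _ _ _ (g := fun y => pot nu s y * pot nu s y))//.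
- exact: integral_pot_sqr.
- by apply/measurable_EFinP; apply: measurable_funM => //; exact: measurable_repr.
- by apply: emeasurable_funM; exact: measurable_pot.
- by move=> y _; rewrite lee_fin -expr2 sqr_ge0.
- by move=> y _; rewrite mule_ge0 ?pot_ge0.
- by move: gE; apply: filterS => y /= /[apply] <-; rewrite EFinM.
Qed.

Lemma S_plus_pot_fin (nu : {sigma_finite_measure set E -> \bar R}) (s : R) :
  S_plus nu -> (0 < s)%R -> \int[L]_y (pot nu s y * pot nu s y) < +oo.
Proof.
move=> /S_plus_small Snu s0; have [t [t0 ts fin]] := Snu s s0.
apply: le_lt_trans (integral_pot_sqr_mono nu t0 ts) _.
by rewrite (integral_pot_sqr nu t0).
Qed.

Lemma S_plus_pot_ae_fin (nu : {sigma_finite_measure set E -> \bar R}) (s : R) :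
  S_plus nu -> (0 < s)%R -> {ae L, forall y, pot nu s y \is a fin_num}.
Proof.
move=> Snu s0.
have : L.-integrable setT (fun y => pot nu s y * pot nu s y).
  apply/integrableP; split.
    by apply: emeasurable_funM; exact: measurable_pot.
  under eq_integral do rewrite gee0_abs ?mule_ge0 ?pot_ge0//.
  exact: S_plus_pot_fin.
move=> /(integrable_ae measurableT); apply: filterS => y /(_ I).
by have := pot_ge0 nu s y; case: (pot nu s y).
Qed.

Lemma S_plus_path (nu : {sigma_finite_measure set E -> \bar R}) : S_plus nu ->
  exists2 x : R -> L2 R d, Ltilde2_plus x & represents nu x.
Proof.
move=> Snu.
have mf s : measurable_fun setT (fun y => fine (pot nu s y)).
  apply: (measurableT_comp (fine_measurable measurableT)).
  exact: measurable_pot.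
have ex (s : R) : exists g : L2 R d, (0 < s)%R -> g = (fun y => fine (pot nu s y)) %[ae L].
  wlog s0 : s / (0 < s)%R.
    move=> h; have [s0|ns0] := pselect (0 < s)%R; first exact: (h s).
    (* Paths are total, so a time [s <= 0] gets an arbitrary value, here the class found at time
       1. *)
    by have [g _] := h 1%R ltr01; exists g.
  suff /(L2_of_fun (mf s))[g gE] : \int[L]_y
    (fine (pot nu s y) * fine (pot nu s y))%:E < +oo by exists g.
  apply: le_lt_trans (S_plus_pot_fin Snu s0).
  apply: le_integral_nomeas => y _; first by rewrite lee_fin -expr2 sqr_ge0.
  by have := pot_ge0 nu s y; case: (pot nu s y) => //= _; rewrite ?EFinM// mulyy leey.
have {ex}[x xE] := choice ex.
have xpot s : (0 < s)%R -> EFin \o x s = pot nu s %[ae L].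
  move=> s0; have := S_plus_pot_ae_fin Snu s0; have := xE s s0.
  by apply: filterS2 => y /= /(_ I) -> yfin _; rewrite fineK.
exists x => //; split.
- move=> r t r0 t0; have rt0 : (0 < r + t)%R by rewrite addr_gt0.
  have := xE _ rt0; apply: filterS => z /= /[apply] ->.
  rewrite /brownian_semigroup t0 /Rintegral; congr fine.
  rewrite addrC -(integral_kern_pot nu z r0 t0).
  apply: ae_eq_integral => //.
  + apply: emeasurable_funM; first exact: measurable_EFin_kern.
    exact: measurable_pot.
  + apply/measurable_EFinP; apply: measurable_funM; first exact: measurable_kern.
    exact: measurable_repr.
  + by have := xpot r r0; apply: filterS => y /= /[apply] <-; rewrite EFinM.
- case: (Snu) => l l0 fin; exists l => //; move: fin; congr (_ < _).
  apply: eq_integral => s; rewrite inE/= in_itv/= => /andP[s0 _].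
  exact/esym/(Lnorm_represents s0 (xpot s s0)).
- move=> s s0; have := xE _ s0; apply: filterS => y /= /(_ I) ->.
  by rewrite fine_ge0// pot_ge0.
Qed.

End S_plus_to_path.

(** * Uniqueness of the measure *)

Section uniqueness.
Context (R : realType) (d : nat).
Notation E := (euclid R d).
Notation L := (lebesgue_euclid R d).
Implicit Types (s t : R) (x y z : E).
Local Open Scope ereal_scope.

(** Uses [a u <= a^2 + u^2] with [a] the kernel, whose square has integral [kern (t + t) x x]. *)
Lemma integral_kern_fin (u : E -> \bar R) t x : (0 < t)%R ->
  measurable_fun setT u -> (forall y, 0 <= u y) ->
  \int[L]_y (u y * u y) < +oo -> \int[L]_y ((kern t y x)%:E * u y) < +oo.
Proof.
move=> t0 mu u0 ufin.
have mk := measurable_EFin_kern t x.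
have k0 y : 0 <= (kern t y x)%:E by rewrite lee_fin kern_ge0.
apply: (@le_lt_trans _ _
    (\int[L]_y ((kern t y x)%:E * (kern t y x)%:E + u y * u y))).
  apply: le_integral_nomeas => y _; first by rewrite mule_ge0.
  move: (k0 y) (u0 y); case: (u y) => [r| |]//; last by move=> _ _; rewrite mulyy addey// leey.
  by rewrite -!EFinM -EFinD !lee_fin => a0 r0; have := sqr_ge0 (kern t y x - r); nra.
rewrite ge0_integralD//; last 4 first.
- by move=> y _; rewrite mule_ge0.
- exact: emeasurable_funM.
- by move=> y _; rewrite mule_ge0.
- exact: emeasurable_funM.
rewrite lte_add_pinfty//; under eq_integral do rewrite -EFinM.
by rewrite integral_kernM// ltry.
Qed.

Section comparison.
Variables mu nu : {sigma_finite_measure set E -> \bar R}.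
Hypothesis potE : forall s, (0 < s)%R -> pot mu s = pot nu s %[ae L].
Hypothesis mu_fin : forall s, (0 < s)%R -> \int[L]_y (pot mu s y * pot mu s y) < +oo.

Lemma pot_fin s x : (0 < s)%R -> pot mu s x < +oo.
Proof.
move=> s0; have s20 : (0 < s / 2)%R by rewrite divr_gt0.
rewrite [s]splitr -integral_kern_pot//.
apply: integral_kern_fin => //; [exact: measurable_pot|exact: pot_ge0|exact: mu_fin].
Qed.

(** Smoothing for the second half of the time turns equality almost everywhere into equality
    everywhere. *)
Lemma pot_eq s x : (0 < s)%R -> pot mu s x = pot nu s x.
Proof.
move=> s0; have s20 : (0 < s / 2)%R by rewrite divr_gt0.
rewrite [s]splitr -(integral_kern_pot mu)// -(integral_kern_pot nu)//.
have mk := measurable_EFin_kern (s / 2) x.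
apply: ge0_ae_eq_integral => //.
- by apply: emeasurable_funM => //; exact: measurable_pot.
- by apply: emeasurable_funM => //; exact: measurable_pot.
- by move=> y _; rewrite mule_ge0 ?pot_ge0// lee_fin kern_ge0.
- by move=> y _; rewrite mule_ge0 ?pot_ge0// lee_fin kern_ge0.
- by have := potE s20; apply: filterS => y /= /[apply] ->.
Qed.

End comparison.

(** * Recovering integrals of Lipschitz functions from potentials at small times *)

Section smoothing.
Variable mu : {sigma_finite_measure set E -> \bar R}.
Variables (h : E -> R) (l : R) (x0 : E).
Hypothesis mh : measurable_fun setT h.
Hypothesis h01 : forall y, (0 <= h y <= 1)%R.
Hypothesis l0 : (0 <= l)%R.
Hypothesis h_lip : forall y z, (h y <= h z + l * Num.sqrt (sqdist y z))%R.

Let h0 y : (0 <= h y)%R. Proof. by case/andP: (h01 y). Qed.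

(** For [0 < s < 1] this is, in [y], [kern 1 x0 z] times the density at time [s] of the Brownian
    bridge from [z] to [x0]; it concentrates at [z] as [s] tends to 0. *)
Let ker2 s y z : R := (kern (1 - s) y x0 * kern s y z)%R.

Let ker2_ge0 s y z : (0 <= ker2 s y z)%R.
Proof. by rewrite mulr_ge0 ?kern_ge0. Qed.

Let mker2 s : measurable_fun setT (fun p : E * E => (ker2 s p.1 p.2)%:E).
Proof.
apply/measurable_EFinP; apply: measurable_funM; last exact: measurable_kern2.
exact: (measurableT_comp (measurable_kern (1 - s) x0)).
Qed.

Let mh1 : measurable_fun setT (fun p : E * E => (h p.1)%:E).
Proof. by apply/measurable_EFinP; exact: (measurableT_comp mh). Qed.

Let mh2 : measurable_fun setT (fun p : E * E => (h p.2)%:E).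
Proof. by apply/measurable_EFinP; exact: (measurableT_comp mh). Qed.

Let smoothed s := \int[L]_y ((h y)%:E * ((kern (1 - s) y x0)%:E * pot mu s y)).

Let smoothedE s : smoothed s = \int[mu]_z \int[L]_y ((h y)%:E * (ker2 s y z)%:E).
Proof.
transitivity (\int[L]_y \int[mu]_z ((h y)%:E * (ker2 s y z)%:E)).
  apply: eq_integral => y _; under [RHS]eq_integral do rewrite /ker2 EFinM muleA.
  have c0 : (0 <= h y * kern (1 - s) y x0)%R by apply: mulr_ge0; [exact: h0|exact: kern_ge0].
  rewrite ge0_integralZl_EFin//; last 2 first.
  - by move=> z _; rewrite lee_fin kern_ge0.
  - exact: measurable_EFin_kernr.
  by rewrite EFinM muleA.
apply: tonelli_swap; first exact: emeasurable_funM.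
by move=> y z; rewrite mule_ge0 ?lee_fin ?h0 ?ker2_ge0.
Qed.

Let exactE s : (0 < s < 1)%R -> \int[mu]_z (h z * kern 1 x0 z)%:E =
  \int[mu]_z \int[L]_y ((h z)%:E * (ker2 s y z)%:E).
Proof.
move=> /andP[s0 s1]; apply: eq_integral => z _.
have s10 : (0 < 1 - s)%R by rewrite subr_gt0.
rewrite ge0_integralZl_EFin ?h0//; last 2 first.
- by move=> y _; rewrite lee_fin ker2_ge0.
- exact: (measurableT_comp (mker2 s) (pair2_measurable z)).
by rewrite integral_kernM// subrK.
Qed.

Let err s z := \int[L]_y (l * (Num.sqrt (sqdist y z) * ker2 s y z))%:E.

Let msq : measurable_fun setT (fun p : E * E => Num.sqrt (sqdist p.1 p.2)).
Proof.
apply: measurableT_comp; last exact: measurable_sqdist2.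
by apply: continuous_measurable_fun; exact: sqrt_continuous.
Qed.

Let merr2 s : measurable_fun setT
  (fun p : E * E => (l * (Num.sqrt (sqdist p.1 p.2) * ker2 s p.1 p.2))%:E).
Proof.
apply/measurable_EFinP; apply: measurable_funM => //; apply: measurable_funM => //.
by apply/measurable_EFinP; exact: mker2.
Qed.

Let err_ge0 s y z : 0 <= (l * (Num.sqrt (sqdist y z) * ker2 s y z))%:E.
Proof.
rewrite lee_fin; apply: mulr_ge0 => //.
by apply: mulr_ge0; [exact: sqrtr_ge0|exact: ker2_ge0].
Qed.

(** [kern_dist] trades the distance for [sqrt s] and a doubled time. Integrating in [y] leaves
    [kern (1 + s)], which [kern_mono] bounds by a multiple of [kern 2]; each of the two bounds costs
    a factor [2^(d/2)]. *)
Let errE s : (0 < s < 1)%R -> \int[mu]_z err s z <=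
  (l * Num.sqrt s * 2 `^ (d%:R / 2) * 2 `^ (d%:R / 2))%:E * pot mu 2 x0.
Proof.
move=> /andP[s0 s1]; have s10 : (0 < 1 - s)%R by rewrite subr_gt0.
have s20 : (0 < 2 * s)%R by rewrite mulr_gt0.
have c0 : (0 <= l * Num.sqrt s * 2 `^ (d%:R / 2))%R.
  by rewrite !mulr_ge0 ?sqrtr_ge0 ?powR_ge0.
rewrite EFinM -muleA -ge0_integralZl_EFin ?powR_ge0//; last 2 first.
- by move=> z _; rewrite lee_fin kern_ge0.
- exact: measurable_EFin_kernr.
rewrite -ge0_integralZl_EFin//; last 2 first.
- by move=> z _; rewrite mule_ge0// lee_fin ?powR_ge0 ?kern_ge0.
- by apply: emeasurable_funM => //; exact: measurable_EFin_kernr.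
apply: le_integral_nomeas => z _; first by apply: integral_ge0 => y _; exact: err_ge0.
apply: (@le_trans _ _ (\int[L]_y ((l * Num.sqrt s * 2 `^ (d%:R / 2))%:E *
    (kern (1 - s) y x0 * kern (2 * s) y z)%:E))).
  apply: le_integral_nomeas => y _; first exact: err_ge0.
  rewrite -EFinM lee_fin /ker2.
  move: (kern_dist y z s0) (kern_ge0 (1 - s) y x0).
  move: (kern (1 - s) y x0) (kern s y z) (kern (2 * s) y z) => a b c bc a0.
  rewrite (_ : l * _ = l * a * (Num.sqrt (sqdist y z) * b))%R; last by ring.
  rewrite [leRHS](_ : _ = l * a * (Num.sqrt s * 2 `^ (d%:R / 2) * c))%R; last by ring.
  by rewrite ler_wpM2l// mulr_ge0.
rewrite ge0_integralZl_EFin//; last 2 first.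
- by move=> y _; rewrite lee_fin mulr_ge0 ?kern_ge0.
- by apply/measurable_EFinP; apply: measurable_funM; exact: measurable_kern.
rewrite integral_kernM// lee_wpmul2l// -EFinM lee_fin.
have -> : (1 - s + 2 * s = 1 + s)%R by ring.
have s1' : (0 < 1 + s)%R by lra.
have s2' : (1 + s <= 2)%R by lra.
apply: (le_trans (kern_mono x0 z s1' s2')).
rewrite ler_wpM2r ?kern_ge0// ge0_ler_powR// ?nnegrE//.
- by rewrite divr_ge0// ltW.
- by rewrite ler_pdivrMr//; lra.
Qed.

Let integralD2 (f g : E -> E -> R) : (forall y z, 0 <= f y z)%R ->
  (forall y z, 0 <= g y z)%R ->
  measurable_fun setT (fun p : E * E => (f p.1 p.2)%:E) ->
  measurable_fun setT (fun p : E * E => (g p.1 p.2)%:E) ->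
  \int[mu]_z \int[L]_y ((f y z)%:E + (g y z)%:E) =
  \int[mu]_z \int[L]_y (f y z)%:E + \int[mu]_z \int[L]_y (g y z)%:E.
Proof.
move=> f0 g0 mf mg; rewrite -ge0_integralD//; last 4 first.
- by move=> z _; apply: integral_ge0 => y _; rewrite lee_fin.
- by apply: (measurable_fun_fubini_tonelli_G _ mf) => p; rewrite lee_fin.
- by move=> z _; apply: integral_ge0 => y _; rewrite lee_fin.
- by apply: (measurable_fun_fubini_tonelli_G _ mg) => p; rewrite lee_fin.
apply: eq_integral => z _; rewrite ge0_integralD//.
- by move=> y _; rewrite lee_fin.
- exact: (measurableT_comp mf (pair2_measurable z)).
- by move=> y _; rewrite lee_fin.
- exact: (measurableT_comp mg (pair2_measurable z)).
Qed.

(** Both values integrate [ker2], against [h z] and [h y] respectively, so the Lipschitz bound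
    compares them. Two inequalities replace a difference of possibly infinite values. *)
Lemma smoothing_error s : (0 < s < 1)%R ->
  let exact_val := \int[mu]_z (h z * kern 1 x0 z)%:E in
  let smooth_val := \int[L]_y ((h y)%:E * ((kern (1 - s) y x0)%:E * pot mu s y)) in
  let error := (l * Num.sqrt s * 2 `^ (d%:R / 2) * 2 `^ (d%:R / 2))%:E * pot mu 2 x0 in
  (exact_val <= smooth_val + error) /\ (smooth_val <= exact_val + error).
Proof.
move=> s01 /=; rewrite -/(smoothed s) smoothedE (exactE s01).
have pos1 y z : (0 <= h y * ker2 s y z)%R by rewrite mulr_ge0 ?h0 ?ker2_ge0.
have pos2 y z : (0 <= h z * ker2 s y z)%R by rewrite mulr_ge0 ?h0 ?ker2_ge0.
have mes1 : measurable_fun setT (fun p : E * E => (h p.1 * ker2 s p.1 p.2)%:E).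
  by under eq_fun do rewrite EFinM; exact: emeasurable_funM.
have mes2 : measurable_fun setT (fun p : E * E => (h p.2 * ker2 s p.1 p.2)%:E).
  by under eq_fun do rewrite EFinM; exact: emeasurable_funM.
have ge0e y z : (0 <= l * (Num.sqrt (sqdist y z) * ker2 s y z))%R.
  by rewrite -lee_fin.
have lip y z : (h y * ker2 s y z <= h z * ker2 s y z +
    l * (Num.sqrt (sqdist y z) * ker2 s y z))%R.
  move: (ker2 s y z) (ker2_ge0 s y z) => a a0.
  by rewrite (mulrA l) -mulrDl ler_wpM2r.
have lip' y z : (h z * ker2 s y z <= h y * ker2 s y z +
    l * (Num.sqrt (sqdist y z) * ker2 s y z))%R.
  move: (ker2 s y z) (ker2_ge0 s y z) => a a0.
  by rewrite (mulrA l) -mulrDl ler_wpM2r// sqdistC.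
split; apply: le_trans (leeD2l _ (errE s01)).
- rewrite /err -[leRHS](integralD2 pos1 ge0e mes1 (merr2 s)).
  apply: le_integral_nomeas => z _.
    by apply: integral_ge0 => y _; rewrite -EFinM lee_fin.
  by apply: le_integral_nomeas => y _; rewrite -EFinM -?EFinD lee_fin.
- rewrite /err -[leRHS](integralD2 pos2 ge0e mes2 (merr2 s)).
  apply: le_integral_nomeas => z _.
    by apply: integral_ge0 => y _; rewrite -EFinM lee_fin.
  by apply: le_integral_nomeas => y _; rewrite -EFinM -?EFinD lee_fin.
Qed.

End smoothing.

(** * Measures with equal potentials coincide *)

Section identification.
Variables mu nu : {sigma_finite_measure set E -> \bar R}.
Hypothesis potE : forall s x, (0 < s)%R -> pot mu s x = pot nu s x.
Hypothesis potfin : forall s x, (0 < s)%R -> pot mu s x < +oo.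

Lemma lip_integral_le (h : E -> R) (l : R) (x0 : E) :
  measurable_fun setT h -> (forall y, 0 <= h y <= 1)%R -> (0 <= l)%R ->
  (forall y z, h y <= h z + l * Num.sqrt (sqdist y z))%R ->
  \int[mu]_z (h z * kern 1 x0 z)%:E <= \int[nu]_z (h z * kern 1 x0 z)%:E.
Proof.
move=> mh h01 l0 lip; apply/lee_addgt0Pr => e e0.
have p0 := pot_ge0 mu 2 x0; have pf : pot mu 2 x0 < +oo by exact: potfin.
pose p := fine (pot mu 2 x0).
have pE : pot mu 2 x0 = p%:E by rewrite fineK// ge0_fin_numE.
have p0' : (0 <= p)%R by rewrite -lee_fin -pE.
pose c := (l * 2 `^ (d%:R / 2) * 2 `^ (d%:R / 2) * p)%R.
have c0 : (0 <= c)%R by rewrite !mulr_ge0 ?powR_ge0.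
(* Smoothing for time [r^2] costs [c * r] for each measure, hence at most [e] in all; the bound
   [1 / 2] keeps [r^2 < 1]. *)
pose r : R := Num.min (1 / 2)%R (e / (2 * c + 1))%R.
have r0 : (0 < r)%R by rewrite lt_min divr_gt0//= divr_gt0//; lra.
have r1 : (r <= 1 / 2)%R by rewrite ge_min lexx.
have re : (2 * (c * r) <= e)%R.
  apply: (@le_trans _ _ ((2 * c + 1) * r)%R); first by nra.
  rewrite mulrC -ler_pdivlMr; last by lra.
  by rewrite /r ge_min lexx orbT.
have s01 : (0 < r ^+ 2 < 1)%R by apply/andP; split; nra.
have sqr : Num.sqrt (r ^+ 2) = r by rewrite sqrtr_sqr gtr0_norm.
have errp : (l * Num.sqrt (r ^+ 2) * 2 `^ (d%:R / 2) * 2 `^ (d%:R / 2))%:E * p%:E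
    = (c * r)%:E by rewrite sqr -EFinM; congr _%:E; rewrite /c; ring.
have [+ _] := smoothing_error mu x0 mh h01 l0 lip s01.
have [_] := smoothing_error nu x0 mh h01 l0 lip s01.
rewrite -potE// pE errp => nule mule.
have smE : \int[L]_y ((h y)%:E * ((kern (1 - r ^+ 2) y x0)%:E * pot mu (r ^+ 2) y)) =
    \int[L]_y ((h y)%:E * ((kern (1 - r ^+ 2) y x0)%:E * pot nu (r ^+ 2) y)).
  by apply: eq_integral => y _; rewrite potE//; case/andP: s01.
rewrite smE in mule.
apply: (le_trans mule); apply: (le_trans (leeD2r _ nule)).
by rewrite -addeA -EFinD leeD2l// lee_fin; lra.
Qed.

End identification.

(** Weighting by [kern 1 x0] gives finite measures, which agree on the pi-system of orthants as
    limits of bumps; the positive weight is then divided out. *)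
Lemma pot_inj (mu nu : {sigma_finite_measure set E -> \bar R}) :
  (forall s x, (0 < s)%R -> pot mu s x = pot nu s x) ->
  (forall s x, (0 < s)%R -> pot mu s x < +oo) ->
  forall A, measurable A -> mu A = nu A.
Proof.
move=> potE potfin A mA; pose x0 : E := point.
have potE' s x : (0 < s)%R -> pot nu s x = pot mu s x by move=> s0; rewrite potE.
have potfin' s x : (0 < s)%R -> pot nu s x < +oo by move=> s0; rewrite -potE// potfin.
have mk := @measurable_kernr R d 1 x0.
have k0 z : (0 <= kern 1 x0 z)%R by exact: kern_ge0.
have [m mE] := density_exists mu mk k0.
have [n nE] := density_exists nu mk k0.
have bumpE o i : \int[m]_z (bump o i z)%:E = \int[n]_z (bump o i z)%:E.
  have mb : measurable_fun setT (fun z => (bump o i z)%:E).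
    by apply/measurable_EFinP; exact: measurable_bump.
  have b0 z : 0 <= (bump o i z)%:E by rewrite lee_fin; case/andP: (bump_bounds o i z).
  rewrite (integral_density mk k0 mE mb b0) (integral_density mk k0 nE mb b0).
  have l0 : (0 <= d%:R * i%:R :> R)%R by rewrite mulr_ge0.
  have mb' := @measurable_bump R d o i.
  apply/eqP; rewrite eq_le; apply/andP; split.
    exact: (lip_integral_le potE potfin x0 mb' (bump_bounds o i) l0 (bump_lip o i)).
  exact: (lip_integral_le potE' potfin' x0 mb' (bump_bounds o i) l0 (bump_lip o i)).
have bump_lim (q : {measure set E -> \bar R}) o :
    \int[q]_z (bump o i z)%:E @[i --> \oo] --> q (orthant o).
  have -> : q (orthant o) = \int[q]_z limn (fun i => (bump o i z)%:E).
    rewrite -(setIT (orthant o)) -integral_indic//; last exact: measurable_orthant.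
    apply: eq_integral => z _; apply/esym/cvg_lim => //.
    by apply: cvg_EFin; [exact: nearW|exact: bump_cvg].
  apply: cvg_monotone_convergence => //.
  - by move=> i; apply/measurable_EFinP; exact: measurable_bump.
  - by move=> i z _; rewrite lee_fin; case/andP: (bump_bounds o i z).
  - by move=> z _ i j ij; rewrite lee_fin bump_le.
have mn B : measurable B -> m B = n B.
  move=> mB; apply: (@g_sigma_algebra_measure_unique _ _ _ (@orthants R d) _ (fun=> setT)).
  - by move=> _ [f _ <-]; exact: measurable_orthant.
  - move=> _; exists (fun=> None) => //; exact/seteqP.
  - by rewrite bigcup_const.
  - exact: setI_closed_orthants.
  - move=> _ [f _ <-]; apply: cvg_unique (bump_lim m f) _ => //.
    rewrite /= (_ : (fun i => \int[m]_z (bump f i z)%:E) =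
      fun i => \int[n]_z (bump f i z)%:E); first exact: bump_lim.
    by apply/funext => i; exact: bumpE.
  (* The total mass of the weighted measure is [pot mu 1 x0]. *)
  - by move=> _; rewrite mE//; exact: potfin.
  - exact: measurable_orthants.
have back (q q' : {measure set E -> \bar R}) :
    (forall B, measurable B -> q' B = \int[q]_(y in B) (kern 1 x0 y)%:E) ->
    q A = \int[q']_y ((\1_A y)%:E * (kern 1 x0 y)^-1%:E).
  move=> qE; rewrite (integral_density mk k0 qE).
  - rewrite -[in LHS](setIT A) -integral_indic//; apply: eq_integral => z _.
    have kz : kern 1 x0 z != 0%R by rewrite lt0r_neq0// kern_gt0.
    by rewrite -muleA -EFinM mulVf// mulr1.
  - apply: emeasurable_funM; apply/measurable_EFinP => //.
    under eq_fun do rewrite -powR_inv1//.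
    exact: (measurableT_comp (measurable_powR _)).
  - by move=> y; rewrite mule_ge0// lee_fin invr_ge0.
rewrite (back _ _ mE) (back _ _ nE); apply: eq_measure_integral => B mB _.
exact: mn.
Qed.

End uniqueness.

(** * From entrance paths to measures *)

Section entrance_semigroup.
Context (R : realType) (d : nat).
Notation E := (euclid R d).
Notation L := (lebesgue_euclid R d).
Implicit Types (r s t : R) (y z : E).
Local Open Scope ereal_scope.

Definition heat (t : R) (u : E -> \bar R) (z : E) := \int[L]_y ((kern t y z)%:E * u y).

Section heat.
Variable u : E -> \bar R.
Hypotheses (mu : measurable_fun setT u) (u0 : forall y, 0 <= u y).

Lemma heat_ge0 t z : 0 <= heat t u z.
Proof. by apply: integral_ge0 => y _; rewrite mule_ge0// lee_fin kern_ge0. Qed.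

Let mku t : measurable_fun setT (fun p : E * E => (kern t p.2 p.1)%:E * u p.2).
Proof.
under eq_fun do rewrite kernC.
apply: emeasurable_funM; first exact: measurable_EFin_kern2.
exact: (measurableT_comp mu).
Qed.

Lemma measurable_heat t : measurable_fun setT (heat t u).
Proof.
apply: (@measurable_integral _ E R _ E L (fun z y => (kern t y z)%:E * u y)) => // z y.
by rewrite mule_ge0// lee_fin kern_ge0.
Qed.

Lemma heatD s t z : (0 < s)%R -> (0 < t)%R -> heat t (heat s u) z = heat (t + s) u z.
Proof.
move=> s0 t0.
have pos y w : 0 <= (kern s w y)%:E * u w by rewrite mule_ge0// lee_fin kern_ge0.
have posz y w : 0 <= (kern t y z)%:E * ((kern s w y)%:E * u w).
  by rewrite mule_ge0// lee_fin kern_ge0.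
transitivity (\int[L]_y \int[L]_w ((kern t y z)%:E * ((kern s w y)%:E * u w))).
  apply: eq_integral => y _; rewrite ge0_integralZl_EFin ?kern_ge0//.
  apply: emeasurable_funM => //; exact: measurable_EFin_kern.
rewrite tonelli_swap//; last first.
  apply: emeasurable_funM; last exact: mku.
  exact: (measurableT_comp (measurable_EFin_kern t z)).
apply: eq_integral => w _.
transitivity (\int[L]_y ((kern t y z * kern s y w)%:E * u w)).
  by apply: eq_integral => y _; rewrite EFinM muleA (kernC s w).
rewrite ge0_integralZr//; last 2 first.
- by apply/measurable_EFinP; apply: measurable_funM; exact: measurable_kern.
- by move=> y _; rewrite lee_fin mulr_ge0// kern_ge0.
by rewrite (integral_kernM z w t0 s0) kernC.
Qed.

End heat.

Lemma eq_heat t (u v : E -> \bar R) z :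
  measurable_fun setT u -> (forall y, 0 <= u y) ->
  measurable_fun setT v -> (forall y, 0 <= v y) ->
  u = v %[ae L] -> heat t u z = heat t v z.
Proof.
move=> mu u0 mv v0 uv; have mk := measurable_EFin_kern t z.
apply: ge0_ae_eq_integral => //; try exact: emeasurable_funM.
- by move=> y _; rewrite mule_ge0// lee_fin kern_ge0.
- by move=> y _; rewrite mule_ge0// lee_fin kern_ge0.
- by move: uv; apply: filterS => y /= /[apply] ->.
Qed.

Variable x : R -> L2 R d.
Hypotheses (xpath : entrance_path x) (xpos : nonnegative_path x).

(** The absolute value gives a version of the path that is nonnegative everywhere, not just almost
    everywhere. *)
Definition dens s (y : E) : \bar R := `|x s y|%:E.

Lemma dens_ge0 s y : 0 <= dens s y. Proof. by rewrite lee_fin. Qed.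

Lemma measurable_dens s : measurable_fun setT (dens s).
Proof.
apply/measurable_EFinP; apply: measurableT_comp => //; exact: measurable_repr.
Qed.

Lemma densE s : (0 < s)%R -> EFin \o x s = dens s %[ae L].
Proof.
by move=> s0; have := xpos s0; apply: filterS => y /= y0 _; rewrite /dens ger0_norm.
Qed.

Lemma heat_dens_fin s t z : (0 < t)%R -> heat t (dens s) z < +oo.
Proof.
move=> t0; apply: integral_kern_fin => //.
- exact: measurable_dens.
- exact: dens_ge0.
have -> : \int[L]_y (dens s y * dens s y) = 'N[L]_2%:E[EFin \o x s] ^+ 2.
  rewrite Lnorm2_sqr; apply: eq_integral => y _.
  by rewrite -EFinM -normrM ger0_norm// -expr2 sqr_ge0.
have fin : 'N[L]_2%:E[EFin \o x s] < +oo by exact: (@Lebesgue_finite _ _ _ _ _ _ (x s)).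
by rewrite expe2 lte_mul_pinfty ?ge0_fin_numE ?Lnorm_ge0.
Qed.

Lemma dens_heat r t : (0 < r)%R -> (0 < t)%R ->
  dens (r + t) = heat t (dens r) %[ae L].
Proof.
move=> r0 t0; have := xpath r0 t0; apply: filterS => z /= /[apply] xE.
rewrite /dens xE /brownian_semigroup t0 /Rintegral.
have -> : \int[L]_y (heat_kernel t (euclid_sub y z) * x r y)%:E = heat t (dens r) z.
  apply: ae_eq_integral => //.
  - apply/measurable_EFinP; apply: measurable_funM; first exact: measurable_kern.
    exact: measurable_repr.
  - apply: emeasurable_funM; first exact: measurable_EFin_kern.
    exact: measurable_dens.
  - by have := densE r0; apply: filterS => y /= /[apply] <-; rewrite EFinM.
have h0 := heat_ge0 (dens_ge0 r) t z.
(* The real-valued integral is the [fine] of the extended one, and finiteness ensures that nothing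
   is lost. *)
rewrite ger0_norm ?fine_ge0// fineK// ge0_fin_numE//.
exact: heat_dens_fin.
Qed.

(** Moves time from the path into the kernel, at every point [z]. *)
Lemma heat_densD s b t z : (0 < s)%R -> (0 < b)%R -> (0 < t)%R ->
  heat t (dens (s + b)) z = heat (t + b) (dens s) z.
Proof.
move=> s0 b0 t0.
rewrite -(heatD (measurable_dens s) (dens_ge0 s))//.
apply: eq_heat; last exact: dens_heat.
- exact: measurable_dens.
- exact: dens_ge0.
- exact: measurable_heat (measurable_dens s) (dens_ge0 s) _.
- exact: heat_ge0 (dens_ge0 s) _.
Qed.

Lemma kern_cvg s y z (f : nat -> R) : (0 < s)%R -> (forall n, (s <= f n)%R) ->
  (f n @[n --> \oo] --> s -> kern (f n) y z @[n --> \oo] --> kern s y z)%R.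
Proof.
move=> s0 fs fcvg.
have f0 n : (0 < f n)%R by exact: lt_le_trans (fs n).
rewrite kernE; under eq_fun do rewrite kernE.
have s20 : (0 < 2 * s)%R by rewrite mulr_gt0.
have ps0 : (0 < 2 * pi * s)%R by rewrite !mulr_gt0// pi_gt0.
apply: cvgM.
  have pE r : (0 < r)%R -> ((2 * pi * r) `^ (- (d%:R / 2)) =
      expR (- (d%:R / 2) * ln (2 * pi * r)))%R.
    by move=> r0; rewrite /powR gt_eqF// !mulr_gt0// pi_gt0.
  rewrite (pE s s0); under eq_fun do rewrite (pE _ (f0 _)).
  apply: continuous_cvg; first exact: continuous_expR.
  apply: cvgM; first exact: cvg_cst.
  apply: continuous_cvg; first exact: continuous_ln.
  by apply: cvgM => //; exact: cvg_cst.
apply: continuous_cvg; first exact: continuous_expR.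
apply: cvgN; apply: cvgM; first exact: cvg_cst.
apply: cvgV; first by rewrite gt_eqF.
by apply: cvgM => //; exact: cvg_cst.
Qed.

(** Dominated convergence: [kern_mono] bounds all kernels at times in [[t, 2 t]] by [2^(d/2)] times
    the kernel at [2 t]. *)
Lemma heat_cvg s t z (f : nat -> R) : (0 < t)%R ->
  (forall n, (t <= f n <= 2 * t)%R) -> (f n @[n --> \oo] --> t)%R ->
  heat (f n) (dens s) z @[n --> \oo] --> heat t (dens s) z.
Proof.
move=> t0 fb fcvg.
have f0 n : (0 < f n)%R by have /andP[/(lt_le_trans t0)] := fb n.
have ma := measurable_dens s; have a0 := dens_ge0 s.
have mk r := measurable_EFin_kern r z.
pose g y := (2 `^ (d%:R / 2))%:E * ((kern (2 * t) y z)%:E * dens s y).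
have g0 y : 0 <= g y by rewrite !mule_ge0 ?lee_fin ?powR_ge0 ?kern_ge0.
have [] := @dominated_convergence _ _ R L setT measurableT
  (fun n y => (kern (f n) y z)%:E * dens s y)
  (fun y => (kern t y z)%:E * dens s y) g => //.
- by move=> n; exact: emeasurable_funM.
- exact: emeasurable_funM.
- apply: nearW => y _; apply: cvgeZr => //.
  apply: cvg_EFin; first exact: nearW.
  by apply: kern_cvg => // n; case/andP: (fb n).
- apply/integrableP; split; first by do 2?apply: emeasurable_funM.
  under eq_integral do rewrite gee0_abs//.
  rewrite ge0_integralZl_EFin ?powR_ge0//; last 2 first.
  + by move=> y _; rewrite mule_ge0// lee_fin kern_ge0.
  + exact: emeasurable_funM.
  by rewrite lte_mul_pinfty ?lee_fin ?powR_ge0// heat_dens_fin// mulr_gt0.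
- apply: nearW => y n _.
  rewrite gee0_abs ?mule_ge0 ?lee_fin ?kern_ge0//.
  rewrite [leRHS]mulrA ler_wpM2r//.
  have /andP[fn1 fn2] := fb n.
  apply: (le_trans (kern_mono y z (f0 n) fn2)).
  rewrite ler_wpM2r ?kern_ge0// ge0_ler_powR// ?nnegrE//.
  + by rewrite divr_ge0// ?ltW// mulr_gt0.
  + by rewrite ler_pdivrMr// ler_wpM2l.
Qed.

End entrance_semigroup.

(** * Decay and oscillation of one-dimensional Gaussians *)

Section gauss.
Context (R : realType).
Variables (t c : R).
Hypothesis t0 : 0 < t.

Definition gauss1 (v : R) : R := expR (- ((v - c) ^+ 2 / (2 * t))).

Lemma gauss1_bounds v : 0 <= gauss1 v <= 1.
Proof.
rewrite /gauss1 expR_ge0/= -[leRHS]expR0 ler_expR oppr_le0.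
by rewrite divr_ge0 ?sqr_ge0// mulr_ge0// ltW.
Qed.

Lemma gauss1_small e : 0 < e ->
  exists2 A, 0 <= A & forall v, A <= `|v| -> gauss1 v <= e.
Proof.
(* Then [|v - c| >= 1 + 2 t / e], so the exponent is at least [1 / e], and exp(x) >= x concludes. *)
move=> e0; exists (`|c| + 1 + 2 * t / e) => [|v Av].
  by rewrite !addr_ge0// divr_ge0 ?mulr_ge0// ltW.
have te0 : 0 < 2 * t / e by rewrite divr_gt0 ?mulr_gt0.
have vc : 1 + 2 * t / e <= `|v - c|.
  by have := ler_distD 0 v c; rewrite subr0 sub0r normrN; have := ler_dist_dist v c;
    rewrite ler_norml; lra.
have v2 : 2 * t / e <= (v - c) ^+ 2.
  by rewrite -[leRHS]ger0_norm ?sqr_ge0// normrX; nra.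
have D : e^-1 <= (v - c) ^+ 2 / (2 * t).
  by rewrite ler_pdivlMr ?mulr_gt0// mulrC.
rewrite /gauss1 expRN -[leRHS]invrK lef_pV2 ?posrE ?expR_gt0 ?invr_gt0//.
apply: le_trans D _; apply: le_trans (expR_ge1Dx _).
by rewrite lerDr.
Qed.

Lemma expRN_lip (a b : R) : 0 <= a -> 0 <= b -> `|expR (- a) - expR (- b)| <= `|a - b|.
Proof.
wlog ab : a b / a <= b => [h a0 b0|a0 b0].
  have [|/ltW] := leP a b => ab; first exact: h.
  by rewrite distrC (distrC a); exact: h.
rewrite ger0_norm; last by rewrite subr_ge0 ler_expR lerN2.
rewrite distrC ger0_norm ?subr_ge0//.
have -> : expR (- b) = expR (- a) * expR (- (b - a)) by rewrite -expRD; congr expR; ring.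
have ea : expR (- a) <= 1 by rewrite -[leRHS]expR0 ler_expR oppr_le0.
have ea0 := expR_ge0 (- a); have := expR_ge1Dx (- (b - a)); nra.
Qed.

(* Outside a large interval [gauss1] is below [e]; inside it, a fine rational
   grid controls its oscillation. *)
Lemma gauss1_osc e : 0 < e -> exists Q : seq rat, forall v w,
  (forall q, q \in Q -> (ratr q <= v) = (ratr q <= w)) ->
  `|gauss1 v - gauss1 w| <= e.
Proof.
move=> e0; have [A A0 small] := gauss1_small e0.
pose N := (Num.truncn A).+1; have AN : A <= N%:R by rewrite ltW// truncnS_gt.
have N0 : 0 <= N%:R :> R by [].
(* A Lipschitz constant of the exponent on [[-N, N]]. *)
pose K := (2 * N%:R + 2 * `|c|) / (2 * t).
have K0 : 0 <= K by rewrite divr_ge0 ?addr_ge0 ?mulr_ge0// ltW.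
pose n := (Num.truncn (K / e)).+1.
have Kn : K / e <= n%:R by rewrite ltW// truncnS_gt.
have n0 : 0 < n%:R :> R by rewrite ltr0n.
have Kne : K / n%:R <= e by rewrite ler_pdivrMr// mulrC -ler_pdivrMr.
pose q j : rat := - N%:R + j%:R / n%:R.
have qE j : ratr (q j) = - N%:R + j%:R / n%:R :> R.
  by rewrite rmorphD rmorphN fmorph_div !rmorph_nat.
exists [seq q j | j <- iota 0 (2 * N * n).+1] => v w.
wlog vw : v w / v <= w => [h sep|sep].
  have [|/ltW] := leP v w => vw; first exact: h.
  by rewrite distrC; apply: h => // p pQ; rewrite sep.
have sepj j : (j <= 2 * N * n)%N -> (- N%:R + j%:R / n%:R <= v) = (- N%:R + j%:R / n%:R <= w).
  by move=> jN; rewrite -!qE sep// map_f// mem_iota add0n ltnS.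
have close a b : gauss1 a <= e -> gauss1 b <= e -> `|gauss1 a - gauss1 b| <= e.
  move=> ae be; have /andP[a0 _] := gauss1_bounds a.
  by have /andP[b0 _] := gauss1_bounds b; rewrite ler_norml; lra.
have sep0 := sepj 0 (leq0n _); rewrite mul0r addr0 in sep0.
have sepN := sepj (2 * N * n)%N (leqnn _).
have NE : - N%:R + (2 * N * n)%:R / n%:R = N%:R :> R.
  by rewrite !natrM mulfK ?gt_eqF//; ring.
rewrite NE in sepN.
have [vN|Nv] := leP (- N%:R) v; last first.
  have wN : w < - N%:R by rewrite ltNge -sep0 -ltNge.
  by apply: close; apply: small; apply: le_trans AN _; rewrite ler0_norm; lra.
have [Nv|vN'] := leP N%:R v.
  by apply: close; apply: small; apply: le_trans AN _; rewrite ger0_norm; lra.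
have wN : w < N%:R by rewrite ltNge -sepN -ltNge.
(* Otherwise the first grid point strictly above [v] would be at most [w] and separate the two. *)
have vwn : w - v <= n%:R^-1.
  rewrite leNgt; apply/negP => lt.
  have vN0 : 0 <= (v + N%:R) * n%:R by rewrite mulr_ge0//; lra.
  pose j := (Num.truncn ((v + N%:R) * n%:R)).+1.
  have /andP[j1 j2] := truncn_itv vN0.
  have jle : (j <= 2 * N * n)%N.
    rewrite /j -(ltr_nat R) (le_lt_trans j1)// !natrM ltr_pM2r//; lra.
  have := sepj j jle.
  have -> : - N%:R + j%:R / n%:R <= w.
    apply: (@le_trans _ _ (v + n%:R^-1)); last by lra.
    rewrite -lerBrDl ler_pdivrMr// /j -natr1 !mulrDl mulVf ?gt_eqF//.
    by rewrite mulrDl in j1; lra.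
  move=> h; have : - N%:R + j%:R / n%:R <= v by rewrite h.
  by rewrite -lerBrDl ler_pdivrMr// opprK leNgt j2.
apply: (@le_trans _ _ (`|w - v| * K)); last first.
  apply: le_trans Kne; rewrite ger0_norm ?subr_ge0// mulrC ler_wpM2l//.
rewrite /gauss1 distrC; apply: le_trans (expRN_lip _ _) _.
- by rewrite divr_ge0 ?sqr_ge0// mulr_ge0// ltW.
- by rewrite divr_ge0 ?sqr_ge0// mulr_ge0// ltW.
have -> : (w - c) ^+ 2 / (2 * t) - (v - c) ^+ 2 / (2 * t) =
   (w - v) * ((w + v - 2 * c) / (2 * t)) by field; rewrite gt_eqF.
have t20 : 0 <= (2 * t)^-1 by rewrite invr_ge0 mulr_ge0// ltW.
rewrite normrM ler_wpM2l// normrM (ger0_norm t20) ler_wpM2r//.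
have c1 := ler_norm c; have c2 := ler_norm (- c); rewrite normrN in c2.
by rewrite ler_norml; lra.
Qed.

End gauss.

(** * Convergence in the extended line from rational cuts *)

Section eventually_sorted.
Context (R : realType).
Variable v : nat -> R.
Let ev (P : nat -> Prop) := \forall k \near \oo, P k.

Lemma limn_esup_ge (a : R) : ev (fun k => a <= v k) ->
  (a%:E <= limn_esup (EFin \o v))%E.
Proof.
move=> av; rewrite limn_esup_lim; apply: lime_ge; first exact: is_cvg_esups.
move: av; apply: filterS => k ak; apply: (@le_trans _ _ (v k)%:E).
  by rewrite lee_fin.
by apply: ereal_sup_ubound; exists k => /=.
Qed.

Lemma limn_esup_le (a : R) : ev (fun k => v k <= a) ->
  (limn_esup (EFin \o v) <= a%:E)%E.
Proof.
move=> [n _ an]; rewrite limn_esup_lim; apply: lime_le; first exact: is_cvg_esups.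
exists n => // k /= nk; apply: ge_ereal_sup => _ [j /= kj <-].
by rewrite lee_fin; apply: an => /=; exact: leq_trans kj.
Qed.

(** Any rational below the limit superior is eventually below the sequence, and any rational above
    it eventually above; density of the rationals squeezes the sequence, also when the limit is
    infinite. *)
Lemma sorted_cvg : (forall q : rat, ev (fun k => ratr q <= v k) \/
  ev (fun k => v k < ratr q)) ->
  EFin \o v @ \oo --> limn_esup (EFin \o v).
Proof.
move=> h.
have lo (q : rat) : ((ratr q : R)%:E < limn_esup (EFin \o v))%E ->
    ev (fun k => ratr q <= v k).
  move=> qL; have [//|vq] := h q; exfalso; move: qL; apply/negP; rewrite -leNgt.
  by apply: limn_esup_le; move: vq; apply: filterS => k /ltW.
have hi (q : rat) : (limn_esup (EFin \o v) < (ratr q : R)%:E)%E ->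
    ev (fun k => v k <= ratr q).
  move=> qL; have [vq|] := h q; last by apply: filterS => k /ltW.
  by exfalso; move: qL; apply/negP; rewrite -leNgt; exact: limn_esup_ge.
case: (limn_esup _) lo hi => [r| |] lo hi.
- apply: cvg_EFin; first exact: nearW.
  apply/cvgrPdist_le => e e0.
  have [q1] : exists q : rat, ratr q \in `]r - e, r[ by apply: rat_in_itvoo; lra.
  have [q2] : exists q : rat, ratr q \in `]r, r + e[ by apply: rat_in_itvoo; lra.
  rewrite !in_itv/= => /andP[q21 q22] /andP[q11 q12].
  have := lo q1; rewrite lte_fin => /(_ q12) l1.
  have := hi q2; rewrite lte_fin => /(_ q21).
  apply: filterS2 l1 => k l1 l2; rewrite ler_norml; lra.
- apply/cvgeyPge => A.
  have [q] : exists q : rat, ratr q \in `]A, A + 1[ by apply: rat_in_itvoo; lra.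
  rewrite in_itv/= => /andP[Aq _]; have := lo q (ltry _).
  by apply: filterS => k qk; rewrite lee_fin (le_trans _ qk)// ltW.
- apply/cvgeNyPle => A.
  have [q] : exists q : rat, ratr q \in `]A - 1, A[ by apply: rat_in_itvoo; lra.
  rewrite in_itv/= => /andP[_ qA]; have := hi q (ltNyr _).
  by apply: filterS => k qk; rewrite lee_fin (le_trans qk)// ltW.
Qed.

End eventually_sorted.

(** * Coding points by rational cuts of their coordinates *)

Section bits.
Context (R : realType) (d : nat).
Notation E := (euclid R d).

(** [pickle] enumerates the pairs of a coordinate and a rational; an index that codes no pair gives
    the constant bit [false]. *)
Definition bit (j : nat) (y : E) : bool :=
  if unpickle j is Some iq then
    ratr (iq : 'I_d * rat).2 <= (tnth y iq.1 : R)
  else false.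

Lemma measurable_bit j : measurable [set y | bit j y].
Proof.
rewrite /bit; case: unpickle => [[i q]|]/=; last first.
  by rewrite (_ : [set _ | _] = set0)//; apply/seteqP; split.
rewrite (_ : [set _ | _] = setT `&` (fun y : E => tnth y i) @^-1` `[ratr q, +oo[).
  by apply: measurable_coord => //; exact: measurable_itv.
by rewrite setTI; apply/seteqP; split => y /=; rewrite in_itv/= andbT.
Qed.

Lemma code_bit j k (y z : E) : (j < k)%N -> code bit k y = code bit k z ->
  bit j y = bit j z.
Proof.
move=> jk yz.
have [//] : code bit j.+1 y = code bit j.+1 z by rewrite !(code_drop _ _ jk) yz.
Qed.

Lemma bit_pickle (i : 'I_d) (q : rat) (y : E) :
  bit (pickle (i, q)) y = (ratr q <= (tnth y i : R)).
Proof. by rewrite /bit pickleK. Qed.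

Lemma kern_gauss1 t (y p : E) :
  kern t y p = (2 * pi * t) `^ (- (d%:R / 2)) *
    \prod_(i < d) gauss1 t (tnth p i) (tnth y i).
Proof.
rewrite kernE; congr (_ * _); rewrite -expR_sum; congr expR.
by rewrite /sqdist mulr_suml -sumrN.
Qed.

(** Finitely many cuts control each Gaussian factor by [gauss1_osc], and [prod_dist_le] passes to
    the product. The depth [k] exceeds the indices of all these cuts. *)
Lemma kern_osc t (p : E) : 0 < t -> forall e, 0 < e ->
  exists k, forall y z, code bit k y = code bit k z -> `|kern t y p - kern t z p| <= e.
Proof.
move=> t0 e e0; pose C := (2 * pi * t) `^ (- (d%:R / 2)).
have C0 : 0 <= C by rewrite powR_ge0.
have Cd : 0 <= C * d%:R by rewrite mulr_ge0.
pose e' := e / (C * d%:R + 1).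
have e'0 : 0 < e' by rewrite divr_gt0//; lra.
have [Q QP] := choice (fun i : 'I_d => gauss1_osc (tnth p i : R) t0 e'0).
pose k := (\max_(i < d) \max_(q <- Q i) pickle (i, q)).+1.
have pk (i : 'I_d) q : q \in Q i -> (pickle (i, q) < k)%N.
  move=> qQ; rewrite ltnS.
  apply: (@leq_trans (\max_(q <- Q i) pickle (i, q))).
    exact: (@leq_bigmax_seq _ (Q i) xpredT (fun q => pickle (i, q))).
  exact: (@leq_bigmax _ (fun i : 'I_d => \max_(q <- Q i) pickle (i, q)) i).
exists k => y z yz.
rewrite !kern_gauss1 -mulrBr normrM (ger0_norm C0) -/C.
have := prod_dist_le (p := fun i => gauss1 t (tnth p i) (tnth y i))
  (q := fun i => gauss1 t (tnth p i) (tnth z i))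
  (fun i => gauss1_bounds _ t0 _) (fun i => gauss1_bounds _ t0 _).
have : \sum_(i < d) `|gauss1 t (tnth p i : R) (tnth y i) -
    gauss1 t (tnth p i : R) (tnth z i)| <= \sum_(i < d) e'.
  apply: ler_sum => i _; apply: QP => q qQ.
  by rewrite -!bit_pickle; apply: code_bit yz; exact: pk.
rewrite sumr_const card_ord => h1 h2.
apply: (le_trans (ler_wpM2l C0 (le_trans h2 h1))).
rewrite -mulr_natr mulrCA /e' -mulrA; apply: ler_piMr; first exact: ltW.
by rewrite mulrC ler_pdivrMr; lra.
Qed.

End bits.

(** * The limit measure on R^d *)

Section limit_measure.
Context (R : realType) (d : nat).
Notation E := (euclid R d).
Variables (nu : nat -> {measure set E -> \bar R}) (M : R).
Hypothesis nuM : forall n, (nu n setT <= M%:E)%E.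
Variables (U : set_system nat) (UF : UltraFilter U).
Let UP : ProperFilter U := @ultra_proper _ _ UF.
Local Existing Instance UP.

Let D : set (measurableTypeR R) := `[0, wt (@bit R d) nu U [::][%classic.
Let path k (u : measurableTypeR R) : E :=
  pt (@bit R d) (branch (@bit R d) nu U k u).
Let coord i k u : R := tnth (path k u) i.
(** The limit superior is measurable in [u] whether or not the coordinates converge; on [D] it is a
    true limit by [coord_cvg]. *)
Let lcoord i u : \bar R := limn_esup (EFin \o coord i ^~ u).
Let finite_pt : set (measurableTypeR R) := [set u | forall i, lcoord i u \is a fin_num].
(** Infinite coordinates become 0 under [fine]; such [u] are discarded through [finite_pt]. *)
Let phi u : E := [tuple fine (lcoord i u) | i < d].

Let coord_cvg i u : D u -> EFin \o coord i ^~ u @ \oo --> lcoord i u.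
Proof.
move=> Du; apply: sorted_cvg => q.
pose j := pickle (i, q).
(* Once level [j] is passed, the answer to the cut at [q] no longer changes with the depth. *)
have bE k : (j < k)%N -> (ratr q <= coord i k u) =
    head false (branch (@bit R d) nu U j.+1 u).
  move=> jk; rewrite /coord -bit_pickle -/j.
  by rewrite -(code_branch (@measurable_bit R d) nuM UF Du jk).
case: (boolP (head false (branch (@bit R d) nu U j.+1 u))) => hb; [left|right].
  by exists j.+1 => // k /= jk; rewrite bE.
by exists j.+1 => // k /= jk; rewrite ltNge bE.
Qed.

Let measurable_lcoord i : measurable_fun setT (lcoord i).
Proof.
apply: measurable_fun_limn_esup => k; apply/measurable_EFinP.
exact: (measurable_code_fun (size_branch (@bit R d) nu U k)
  (@measurable_branch _ _ _ (@bit R d) nu U k)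
  (fun w => tnth (pt (@bit R d) w) i : R)).
Qed.

Let measurable_phi : measurable_fun setT phi.
Proof.
apply/measurable_fun_tnthP => i.
rewrite (_ : _ \o _ = fine \o lcoord i).
  by apply: measurableT_comp => //; exact: measurable_lcoord.
by apply/funext => u; rewrite /= tnth_mktuple.
Qed.

Let measurable_finite_pt : measurable finite_pt.
Proof.
rewrite (_ : finite_pt = \bigcap_(i in [set: 'I_d]) [set u | lcoord i u \is a fin_num]).
  apply: fin_bigcap_measurable => // i _.
  rewrite -[X in measurable X]setTI.
  by apply: emeasurable_fin_num => //; exact: measurable_lcoord.
by apply/seteqP; split=> x h i; [move=> _; exact: h|exact: h].
Qed.

(** If a coordinate runs off to infinity, its Gaussian factor tends to 0 while the others stay at
    most 1; otherwise the kernel is continuous along the path. *)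
Let kern_path_cvg t (p : E) u : 0 < t -> D u ->
  kern t (path k u) p @[k --> \oo] --> (kern t (phi u) p * \1_finite_pt u : R).
Proof.
move=> t0 Du; have [fu|nfu] := pselect (finite_pt u).
  rewrite indicE mem_set// mulr1 kern_gauss1; under eq_fun do rewrite kern_gauss1.
  apply: cvgM; first exact: cvg_cst.
  apply: cvg_big => [|i _]; first exact: mul_continuous.
  rewrite /gauss1; apply: continuous_cvg; first exact: continuous_expR.
  apply: cvgN; apply: cvgM; last exact: cvg_cst.
  have c : coord i k u @[k --> \oo] --> (tnth (phi u) i : R).
    have := @coord_cvg i u Du; rewrite -(fineK (fu i)) => /fine_cvg.
    by rewrite tnth_mktuple.
  rewrite expr2; under eq_fun do rewrite expr2.
  by apply: cvgM; apply: cvgB => //; exact: cvg_cst.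
rewrite indicE memNset// mulr0.
move/existsNP: nfu => [i ni].
pose C := (2 * pi * t) `^ (- (d%:R / 2)).
have C0 : 0 <= C by rewrite powR_ge0.
apply/cvgrPdist_le => e e0.
have e'0 : 0 < e / (C + 1) by rewrite divr_gt0//; lra.
have [A A0 small] := gauss1_small (tnth p i : R) t0 e'0.
have big : \forall k \near \oo, A <= `|coord i k u|.
  have := @coord_cvg i u Du; case: (lcoord i u) ni => [//| |] _.
    move/cvgeyPge => /(_ A); apply: filterS => k; rewrite lee_fin => Ak.
    exact: le_trans Ak (ler_norm _).
  move/cvgeNyPle => /(_ (- A)); apply: filterS => k; rewrite lee_fin => Ak.
  by rewrite -normrN; apply: le_trans (ler_norm _); rewrite lerNr.
move: big; apply: filterS => k /small ke.
rewrite sub0r normrN ger0_norm ?kern_ge0// kern_gauss1 (bigD1 i)//=.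
have g01 j := gauss1_bounds (tnth p j : R) t0 (tnth (path k u) j).
apply: (@le_trans _ _ (C * (e / (C + 1)))).
  rewrite ler_wpM2l// (le_trans _ ke)// ler_piMr//; first by case/andP: (g01 i).
  by apply: prodr_ile1 => j _; exact: g01.
rewrite mulrCA; apply: ler_piMr; first exact: ltW.
by rewrite ler_pdivrMr; lra.
Qed.

(** The measure is the image under [phi] of Lebesgue measure on [D] intersected with [finite_pt],
    and heat kernels satisfy the hypotheses of [ultralimit_integral]. *)
Lemma heat_ultralimit : exists mu : {measure set E -> \bar R},
  forall t p, 0 < t ->
  (\int[nu n]_y (kern t y p)%:E)%E @[n --> U] --> (\int[mu]_y (kern t y p)%:E)%E.
Proof.
have mD : measurable D by exact: measurable_itv.
have mDf : measurable (D `&` finite_pt) by exact: measurableI.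
have mi : measurable_fun setT (\1_(D `&` finite_pt) : measurableTypeR R -> R).
  exact/measurable_indicP.
have i0 u : 0 <= (\1_(D `&` finite_pt) u : R) by [].
have [m mE] := density_exists (@lebesgue_measure R) mi i0.
pose mu : {measure set E -> \bar R} :=
  measure_function_pushforward__canonical__measure_function_Measure m measurable_phi.
exists mu => t p t0.
have mk := @measurable_EFin_kern R d t p.
have -> : (\int[mu]_y (kern t y p)%:E)%E =
    (\int[lebesgue_measure]_(u in D) (kern t (phi u) p * \1_finite_pt u)%:E)%E.
  rewrite /mu ge0_integral_pushforward//; last first.
    by move=> y _; rewrite lee_fin kern_ge0.
  rewrite preimage_setT (integral_density mi i0 mE)//; last 2 first.
  - exact: (measurableT_comp mk measurable_phi).
  - by move=> u; rewrite lee_fin kern_ge0.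
  rewrite [RHS]integral_mkcond; apply: eq_integral => u _.
  rewrite epatch_indic /= -!EFinM indicI; congr _%:E.
  by rewrite /=; ring.
have C0 u : 0 <= kern t (phi u) p * \1_finite_pt u <= (2 * pi * t) `^ (- (d%:R / 2)).
  rewrite mulr_ge0 ?kern_ge0//=; apply: le_trans (kern_le (phi u) p t0).
  by rewrite ler_piMr ?kern_ge0// indicE; case: (_ \in _).
apply: (ultralimit_integral (@measurable_bit R d) nuM UF) => //.
- exact: measurable_kern.
- apply: measurable_funTS; apply: measurable_funM; last exact/measurable_indicP.
  exact: (measurableT_comp (measurable_kern t p) measurable_phi).
- by move=> y; rewrite kern_ge0 kern_le.
- exact: kern_osc.
- by move=> u Du; exact: kern_path_cvg.
Qed.

End limit_measure.

(** * The measure of an entrance path *)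

Section path_to_measure.
Context (R : realType) (d : nat).
Notation E := (euclid R d).
Notation L := (lebesgue_euclid R d).
Local Open Scope ereal_scope.
Variable x : R -> L2 R d.
Hypotheses (xpath : entrance_path x) (xpos : nonnegative_path x).

Let origin : E := [tuple 0%R | i < d].
(** Times tending to 0, started at 1/3 to stay below 1/2. *)
Let r (n : nat) : R := n.+3%:R^-1.

Let r_gt0 n : (0 < r n)%R. Proof. by rewrite invr_gt0. Qed.

Let r_lt n : (r n < 1 / 2)%R.
Proof. by rewrite div1r ltf_pV2 ?posrE// ltr_nat. Qed.

Let r_cvg : (r n @[n --> \oo] --> 0)%R.
Proof.
apply/cvgrPdist_le => e e0.
have := @nbhs_infty_ger R e^-1; apply: filterS => n en.
rewrite sub0r normrN gtr0_norm// -[leRHS]invrK lef_pV2 ?posrE ?invr_gt0//.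
by apply: le_trans en _; rewrite ler_nat; exact: leq_trans (leqnSn _) (leq_addl 2 _).
Qed.

Let rho n (y : E) : R := (kern 1 y origin * `|x (r n) y|)%R.

Let rho_ge0 n y : (0 <= rho n y)%R.
Proof. by apply: mulr_ge0 => //; exact: kern_ge0. Qed.

Let measurable_rho n : measurable_fun setT (rho n).
Proof.
apply: measurable_funM; first exact: measurable_kern.
apply: measurableT_comp => //; exact: measurable_repr.
Qed.

(** The mass is [heat 1] of the path at [r n], hence [heat (1/2 + r n)] of the path at 1/2, and
    [kern_mono] removes the dependence on [n]. *)
Let rho_mass n : \int[L]_y (rho n y)%:E <=
  (2 `^ (d%:R / 2))%:E * heat 1 (dens x (1 / 2)) origin.
Proof.
have h0 : (0 < 1 / 2 - r n)%R by rewrite subr_gt0 r_lt.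
have h1 : (0 < 1 / 2 + r n)%R by rewrite addr_gt0.
have h2 : (1 / 2 + r n <= 1)%R by have := r_lt n; lra.
have -> : \int[L]_y (rho n y)%:E = heat (1 / 2 + r n) (dens x (1 / 2)) origin.
  have -> : (1 / 2 = r n + (1 / 2 - r n) :> R)%R by ring.
  rewrite (heat_densD xpath xpos origin (r_gt0 n) h0); last by lra.
  have -> : (r n + (1 / 2 - r n) + r n + (1 / 2 - r n) = 1 :> R)%R by field.
  by apply: eq_integral => y _; rewrite -EFinM.
rewrite -ge0_integralZl_EFin ?powR_ge0//; last 2 first.
- by move=> y _; rewrite mule_ge0// ?dens_ge0// lee_fin kern_ge0.
- apply: emeasurable_funM; first exact: measurable_EFin_kern.
  exact: measurable_dens.
apply: le_integral_nomeas => y _.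
  by rewrite mule_ge0// ?dens_ge0// lee_fin kern_ge0.
rewrite muleA -[_%:E * (kern 1 _ _)%:E]EFinM lee_wpmul2r ?dens_ge0// lee_fin.
apply: (le_trans (kern_mono y origin h1 h2)).
rewrite ler_wpM2r ?kern_ge0// ge0_ler_powR// ?nnegrE//.
- by rewrite divr_ge0// ltW.
- by rewrite ler_pdivrMr//; have := r_gt0 n; lra.
Qed.

Let heat_r_cvg t z : (0 < t)%R ->
  heat t (dens x (r n)) z @[n --> \oo] --> heat (t / 2) (dens x (t / 2)) z.
Proof.
move=> t0; have t20 : (0 < t / 2)%R by rewrite divr_gt0.
(* The minimum keeps every [f n] in the range that [heat_cvg] requires; eventually it equals
   [r n]. *)
pose f n : R := (t / 2 + Num.min (r n) (t / 2))%R.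
have fb n : (t / 2 <= f n <= 2 * (t / 2))%R.
  by rewrite /f mulr2n mulrDl mul1r lerD2l lerDl le_min ge_min lexx orbT !ltW.
have near_r : \forall n \near \oo, (r n < t / 2)%R.
  by move/cvgrPdist_lt : r_cvg => /(_ _ t20); apply: filterS => n;
    rewrite sub0r normrN gtr0_norm.
have fcvg : (f n @[n --> \oo] --> t / 2)%R.
  rewrite -[X in _ --> X]addr0; apply: cvgD; first exact: cvg_cst.
  apply: cvg_trans r_cvg; apply: near_eq_cvg.
  by move: near_r; apply: filterS => n rn; rewrite min_l// ltW.
have hc := @heat_cvg R d x (t / 2)%R (t / 2)%R z f t20 fb fcvg.
apply: cvg_trans hc; apply: near_eq_cvg.
move: near_r; apply: filterS => n rn.
have h0 : (0 < t / 2 - r n)%R by rewrite subr_gt0.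
rewrite /f min_l ?ltW// -[in dens x (t / 2)](subrKC (r n) (t / 2)).
rewrite (heat_densD xpath xpos z (r_gt0 n) h0); last by rewrite addr_gt0.
by have -> : (t / 2 + r n + (t / 2 - r n) = t)%R by field.
Qed.

(** [tau] and [p] are chosen so that completing the square with [kern 1 y origin] gives time
    [tau / (tau + 1) = t] and centre [p / (tau + 1) = z]. *)
Let kern_quotient t y z : (0 < t < 1)%R ->
  let tau := (t / (1 - t))%R in
  let p : E := [tuple ((tnth z i : R) / (1 - t))%R | i < d] in
  (kern tau y p * kern 1 y origin = kern (tau + 1) p origin * kern t y z)%R.
Proof.
move=> /andP[t0 t1] tau p; have t10 : (0 < 1 - t)%R by rewrite subr_gt0.
have tau0 : (0 < tau)%R by rewrite divr_gt0.
have tau1 : (0 < tau + 1)%R by rewrite addr_gt0.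
rewrite kernM//.
have -> : (tau * 1 / (tau + 1) = t)%R.
  by rewrite /tau; field; apply/andP; split; rewrite ?gt_eqF//; lra.
congr (_ * kern _ _ _)%R; apply: eq_from_tnth => i.
rewrite !tnth_mktuple mulr0 addr0 mul1r /tau.
by field; apply/andP; split; rewrite ?gt_eqF//; lra.
Qed.

(* The measures [kern 1 . origin * x (r n)] have bounded mass, and the ratio of
   [kern t . z] to [kern 1 . origin] is again a heat kernel up to a constant, so
   that a limit measure of these tests correctly against it. *)
Lemma entrance_measure : exists mu : {measure set E -> \bar R},
  forall t z, (0 < t < 1)%R ->
  \int[mu]_y (kern t z y)%:E = heat (t / 2) (dens x (t / 2)) z.
Proof.
have [nu nuE] := choice (fun n => density_exists L (measurable_rho n) (rho_ge0 n)).
pose M := fine ((2 `^ (d%:R / 2))%:E * heat 1 (dens x (1 / 2)) origin).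
have nuM n : nu n setT <= M%:E.
  rewrite nuE// fineK ?rho_mass// ge0_fin_numE; last first.
    by rewrite mule_ge0 ?lee_fin ?powR_ge0// heat_ge0//; exact: dens_ge0.
  by rewrite lte_mul_pinfty ?lee_fin ?powR_ge0// heat_dens_fin.
(* [U] refines the filter of cofinal segments, so an ordinary limit in [n] is also the limit along
   [U]. *)
have [U [UF Uoo]] := ultraFilterLemma eventually_filter.
have UP : ProperFilter U by exact: ultra_proper.
have [m mE] := heat_ultralimit nuM UF.
have mk : measurable_fun setT (fun y : E => (kern 1 y origin)^-1%R).
  under eq_fun do rewrite -powR_inv1 ?kern_ge0//.
  exact: (measurableT_comp (measurable_powR _) (measurable_kern 1 origin)).
have k0 (y : E) : (0 <= (kern 1 y origin)^-1)%R by rewrite invr_ge0 kern_ge0.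
have [mu muE] := density_exists m mk k0.
exists mu => t z t01; have /andP[t0 t1] := t01.
pose tau := (t / (1 - t))%R.
pose p : E := [tuple ((tnth z i : R) / (1 - t))%R | i < d].
have t10 : (0 < 1 - t)%R by rewrite subr_gt0.
have tau0 : (0 < tau)%R by rewrite divr_gt0.
have [c c0 kq] : exists2 c : R, (0 < c)%R & forall y,
    (kern tau y p * kern 1 y origin = c * kern t y z)%R.
  exists (kern (tau + 1) p origin) => [|y]; first by rewrite kern_gt0// addr_gt0.
  exact: kern_quotient.
have c0' := ltW c0; have ci0 : (0 <= c^-1)%R by rewrite invr_ge0.
have intnu n : \int[nu n]_y (kern tau y p)%:E = c%:E * heat t (dens x (r n)) z.
  rewrite (integral_density (measurable_rho n) (rho_ge0 n) (nuE n))//; last 2 first.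
  - exact: measurable_EFin_kern.
  - by move=> y; rewrite lee_fin kern_ge0.
  transitivity (\int[L]_y (c%:E * ((kern t y z)%:E * dens x (r n) y))).
    apply: eq_integral => y _.
    rewrite /rho /dens; move: (kern tau y p) (kern 1 y origin) (kern t y z) (kq y).
    move=> a b e abce; rewrite -!EFinM; congr _%:E.
    by rewrite [LHS]mulrA abce -mulrA.
  rewrite ge0_integralZl_EFin//.
  - by move=> y _; rewrite mule_ge0// ?dens_ge0// lee_fin kern_ge0.
  - by apply: emeasurable_funM; [exact: measurable_EFin_kern|exact: measurable_dens].
have intm : \int[m]_y (kern tau y p)%:E = c%:E * heat (t / 2) (dens x (t / 2)) z.
  apply: cvg_unique (mE tau p tau0) _ => //.
  have lim : \int[nu n]_y (kern tau y p)%:E @[n --> \oo] -->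
      c%:E * heat (t / 2) (dens x (t / 2)) z.
    under eq_fun do rewrite intnu.
    by apply: cvgeZl => //; exact: heat_r_cvg.
  by move=> A /lim; exact: Uoo.
transitivity (c^-1%:E * \int[m]_y (kern tau y p)%:E); last first.
  by rewrite intm muleA -EFinM mulVf ?mul1e// gt_eqF.
rewrite (integral_density mk k0 muE); last 2 first.
- exact: measurable_EFin_kernr.
- by move=> y; rewrite lee_fin kern_ge0.
transitivity (\int[m]_y (c^-1%:E * (kern tau y p)%:E)); last first.
  rewrite ge0_integralZl_EFin//; last exact: measurable_EFin_kern.
  by move=> y _; rewrite lee_fin kern_ge0.
apply: eq_integral => y _; rewrite kernC.
have k1 : kern 1 y origin != 0%R by rewrite lt0r_neq0// kern_gt0.
move: (kern tau y p) (kern 1 y origin) (kern t y z) (kq y) k1 => a b e abce b0.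
rewrite -!EFinM; congr _%:E; apply: (mulIf b0).
by rewrite -mulrA mulVf// mulr1 -mulrA abce mulKf// gt_eqF.
Qed.

Lemma path_measure :
  exists nu : {sigma_finite_measure set E -> \bar R}, represents nu x.
Proof.
have [mu muE] := entrance_measure.
have h0 s z : 0 <= heat s (dens x s) z by apply: heat_ge0; exact: dens_ge0.
have mu_sfin : sigma_finite setT mu.
  have h12 : (0 < 1 / 2 :> R)%R by [].
  apply: (@kern_sigma_finite _ _ _ (1 / 2)%R origin) => //.
  rewrite muE; last by apply/andP; split; lra.
  by apply: heat_dens_fin; rewrite divr_gt0.
have [nu nuE] := sigma_finite_pack mu_sfin.
(* This [t] is below both 1 and [s]: [entrance_measure] identifies the potential at [t], and the
   semigroup carries the identity on to [s]. *)
exists nu => s s0; pose t := (Num.min s 1 / 2)%R.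
have m0 : (0 < Num.min s 1)%R by rewrite lt_min s0/=.
have m1 : (Num.min s 1 <= 1)%R by rewrite ge_min lexx orbT.
have ms : (Num.min s 1 <= s)%R by rewrite ge_min lexx.
have t0 : (0 < t)%R by rewrite divr_gt0.
have t20 : (0 < t / 2)%R by rewrite divr_gt0.
have t1 : (t < 1)%R by rewrite /t; lra.
have st0 : (0 < s - t)%R by rewrite /t; lra.
have st20 : (0 < s - t / 2)%R by rewrite /t; lra.
have potE : pot nu t = heat (t / 2) (dens x (t / 2)).
  by apply/funext => z; rewrite /pot nuE muE// t0.
have ma := measurable_dens x (t / 2); have a0 := dens_ge0 x (t / 2).
have sE z : pot nu s z = heat (s - t / 2) (dens x (t / 2)) z.
  have -> : (s - t / 2 = s - t + t / 2)%R by field.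
  rewrite -(heatD ma a0 z t20 st0) -potE -[in LHS](subrK t s).
  exact/esym/integral_kern_pot.
have := densE xpos s0; have := dens_heat xpath xpos t20 st20.
rewrite subrKC; apply: filterS2 => z /(_ I) h1 /(_ I) h2 _.
by rewrite h2 h1 -sE.
Qed.

End path_to_measure.

(** * Assembly of the correspondence *)

Lemma Ltilde2_measure (R : realType) (d : nat) (x : R -> L2 R d) :
  Ltilde2_plus x -> exists2 nu : {sigma_finite_measure set (euclid R d) -> \bar R},
    S_plus nu & represents nu x.
Proof.
move=> [xpath [l l0 lfin] xpos].
have [nu nux] := path_measure xpath xpos; exists nu => //; exists l => //.
apply: le_lt_trans lfin; rewrite le_eqVlt; apply/orP; left; apply/eqP.
apply: eq_integral => s; rewrite inE/= in_itv/= => /andP[s0 _].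
exact/esym/(Lnorm_represents s0 (nux s s0)).
Qed.

Theorem theorem5p1 (R : realType) (d : nat) :
  [/\ forall mu : {measure set (euclid R d) -> \bar R}, S_plus mu ->
        exists2 x : R -> L2 R d, Ltilde2_plus x & represents mu x,
      forall x : R -> L2 R d, Ltilde2_plus x ->
        exists2 mu : {measure set (euclid R d) -> \bar R},
          S_plus mu & represents mu x,
      forall (mu : {measure set (euclid R d) -> \bar R}) (x y : R -> L2 R d),
        S_plus mu -> Ltilde2_plus x -> Ltilde2_plus y ->
        represents mu x -> represents mu y -> path_equal x y
    & forall (mu nu : {measure set (euclid R d) -> \bar R}) (x : R -> L2 R d),
        S_plus mu -> S_plus nu -> Ltilde2_plus x ->
        represents mu x -> represents nu x -> measure_equal mu nu].
Proof.
(* An equality of measures, not only of set functions, allows [mu] to be rewritten into its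
   sigma-finite version everywhere. *)
have pack (mu : {measure set (euclid R d) -> \bar R}) : S_plus mu ->
    exists mu' : {sigma_finite_measure set (euclid R d) -> \bar R},
      mu = mu' :> {measure set _ -> \bar R}.
  move=> /S_plus_sigma_finite/sigma_finite_pack[mu' mu'E]; exists mu'.
  exact/esym/eq_measure.
split.
- move=> mu Smu; have [mu' mu'E] := pack _ Smu.
  by rewrite mu'E in Smu *; exact: S_plus_path.
- by move=> x /Ltilde2_measure[nu Snu nux]; exists nu.
- move=> mu x y _ _ _ mux muy s s0; apply: L2_eqP.
  have := mux s s0; have := muy s s0.
  by apply: filterS2 => z /(_ I)/= yz /(_ I)/= xz _; apply: EFin_inj; rewrite xz yz.
- move=> mu nu x Smu Snu _ mux nux.
  have [mu' mu'E] := pack _ Smu; have [nu' nu'E] := pack _ Snu.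
  rewrite mu'E nu'E in Smu Snu mux nux *.
  have potE s : 0 < s -> pot mu' s = pot nu' s %[ae lebesgue_euclid R d].
    move=> s0; have := mux s s0; have := nux s s0.
    by apply: filterS2 => z /(_ I)/= nuz /(_ I)/= muz _; rewrite -[LHS]muz -[RHS]nuz.
  have fin s : 0 < s -> (\int[lebesgue_euclid R d]_y (pot mu' s y * pot mu' s y) < +oo)%E.
    exact: S_plus_pot_fin.
  apply: pot_inj => s z s0; first exact: pot_eq.
  exact: pot_fin.
Qed.
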